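(* For the second price auction with a profit and loss sharing contract (PLSC) and weakly risk averse buyers in the presence of the principal-agent relationship described in the context, $$\frac{d R^{plsc}_{sp-pa}(\alpha)}{d\alpha}\bigg|_{\alpha=0}>0,$$ where the derivative at $\alpha=0$ is the right derivative and $$R^{plsc}_{sp-pa}(\alpha)=\mathbb{E}\big[\alpha X_1+\alpha e(\alpha)+(1-\alpha)t(\alpha,Z_1,Z_1)\,\big|\,Y_1>Z_1\big],\qquad \alpha\in[0,1).$$
   Context: ''Increasing'' means strictly increasing. There are $N\ge 2$ buyers. Real random variables $X_n$ (nominal value of the resource to buyer $n$, a continuous random variable) and $Y_n$ (signal observed only by buyer $n$), $1\le n\le N$, have a commonly known joint law; $\mathbf{Y}=(Y_1,\dots,Y_N)$ and $\mathbf{Y}_{-n}$ is $\mathbf{Y}$ without the $n$-th entry. Symmetry: the joint CDF of $(X_n,Y_n,\mathbf{Y}_{-n})$ is the same for every $n$ and symmetric in the last $N-1$ components. The sets $\mathcal{I}_X$ of possible values of $X_1$, $\mathcal{I}_Y$ of possible values of $Y_1$, and $\mathcal{E}$ of possible efforts are closed bounded intervals of $\mathbb{R}$. $\mathbf{Y}$ has a joint density positive on all of $\mathcal{I}_Y^N$. Positive dependence: for any increasing $h:\mathbb{R}\to\mathbb{R}$ and $a_n\le b_n$ in $\mathcal{I}_Y$, $\mathbb{E}[h(X_1)\mid Y_1\in[a_1,b_1],\dots,Y_N\in[a_N,b_N]]$ is increasing in $a_1$ and $b_1$ and nondecreasing in $a_n,b_n$ for $n\ge2$, whenever it exists ($a_n=b_n$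 means conditioning on $Y_n=a_n$). Continuity: for any continuous $h:\mathbb{R}\to\mathbb{R}$ the same conditional expectation is continuous in the $a_n$'s and $b_n$'s whenever it exists. Weakly risk averse buyers: all buyers have the same utility of money $u:\mathbb{R}\to\mathbb{R}$, concave (possibly linear), increasing, $u(0)=0$. All expectations and conditional expectations of interest exist and are finite, and $\mathbb{E}[u(X_1)\mid\mathbf{Y}=\mathbf{y}]>0$ for all $\mathbf{y}\in\mathcal{I}_Y^N$. $Z_1=\max\{Y_2,\dots,Y_N\}$. Principal-agent relationship: the winner $n$ chooses an effort $e\in\mathcal{E}$, unobservable to the seller, at monetary cost $c(e)$, and the value becomes $X_n+e$. If he paid $b$ in the auction (the second highest bid) and the nominal value is $x$, he pays the seller a further $\alpha(x+e-b)$, so his total profit is $(1-\alpha)(x-b)+(1-\alpha)e-c(e)$. The cost function $c$ is nonnegative, increasing, convex, continuously differentiable, with $\inf_{e\in\mathcal{E}}c'(e)<1$ and $\sup_{e\in\mathcal{E}}c'(e)>1$. For each $\alpha\in[0,1)$ there is a unique $e(\alpha)\in\mathcal{E}$ maximizing $(1-\alpha)e-c(e)$; set $\kappa(\alpha)=(1-\alpha)e(\alpha)-c(e(\alpha))$. $t(\alpha,y_1,z_1)$ is the unique $b$ with $\mathbb{E}[u((1-\alpha)(X_1-b)+\kappa(\alpha))\mid Y_1=y_1,Z_1=z_1]=0$. $R^{plsc}_{sp-pa}(\alpha)$ is the seller's expected total revenue (auction payment plus profit share) at the symmetric equilibrium in which buyer $n$ bids $t(\alpha,Y_n,Y_n)$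 and the winner exerts effort $e(\alpha)$. *)

(* Defs.v *)
From HB Require Import structures.
From mathcomp Require Export all_boot all_order all_algebra all_fingroup.
From mathcomp Require Export all_classical all_reals all_analysis.
From mathcomp Require Export measurable_realfun.
Export Order.TTheory GRing.Theory Num.Theory numFieldNormedType.Exports.

Set Implicit Arguments.
Unset Strict Implicit.
Unset Printing Implicit Defensive.

Global Open Scope classical_set_scope.
Global Open Scope ring_scope.

(* There are m.+2 buyers, indexed by 'I_m.+2; the distinguished buyer "1" is
   ord0, and the opponents of buyer n are the lift n j with j : 'I_m.+1.
   Vectors of signals (and the corners of boxes) are row vectors. *)

Section RealFunctions.
Context {R : realType}.

Definition concave_function (u : R -> R) :=
  convex_function ([set: R] : set R) (\- u).

(* The limit is taken inside [l, r], hence is one-sided at l and r. *)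
Definition derivative_on (l r : R) (f df : R -> R) :=
  forall x, l <= x <= r ->
    (f y - f x) / (y - x) @[y --> within `[l, r] x^'] --> df x.

Definition C1_on (l r : R) (f df : R -> R) :=
  derivative_on l r f df /\ {within `[l, r], continuous df}.

(* Stands for the n-dimensional Lebesgue integral of a nonnegative measurable
   function (Tonelli). *)
Fixpoint iter_integral n : (n.-tuple R -> \bar R) -> \bar R :=
  if n is n'.+1 then
    fun f => (\int[lebesgue_measure]_x
                 iter_integral (fun t => f [tuple of x :: t]))%E
  else fun f => f [tuple].

End RealFunctions.

Section Law.
Context d (T : measurableType d) (R : realType) (P : probability T R).

(* The set of possible values of X, read as the support of its law. *)
Definition is_support (X : T -> R) (I : set R) :=
  [/\ closed I, P (X @^-1` I) = 1%E &
      forall J, closed J -> P (X @^-1` J) = 1%E -> I `<=` J].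

Definition is_joint_density n (Y : 'I_n -> T -> R) (f : n.-tuple R -> R) :=
  [/\ measurable_fun setT f, (forall y, 0 <= f y) &
      forall B : set (n.-tuple R), measurable B ->
        P [set w | B [tuple Y i w | i < n]] =
        iter_integral (fun y => (f y * \1_B y)%:E)].

Definition cond_expectation (A : set T) (f : T -> R) : R :=
  (\int[P]_(w in A) f w) / fine (P A).

End Law.

Section Auction.
Context d (T : measurableType d) (R : realType) (P : probability T R).
Variable m : nat.
Implicit Types (X Y : 'I_m.+2 -> {RV P >-> R}).

Definition joint_cdf X Y (n : 'I_m.+2) (x y : R) (z : 'I_m.+1 -> R) :=
  P [set w | [/\ X n w <= x, Y n w <= y & forall j, Y (lift n j) w <= z j]].

Definition symmetric_law X Y :=
  (forall n x y z, joint_cdf X Y n x y z = joint_cdf X Y ord0 x y z) /\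
  (forall n x y z (s : {perm 'I_m.+1}),
     joint_cdf X Y n x y (z \o s) = joint_cdf X Y n x y z).

Definition max_others (v : 'I_m.+2 -> R) (n : 'I_m.+2) : R :=
  \big[Num.max/v (lift n ord0)]_(j < m.+1) v (lift n j).

Definition Z1 Y (w : T) : R := max_others (fun n => Y n w) ord0.

Definition splice (D : {set 'I_m.+2}) (v a : 'rV[R]_m.+2) : 'rV[R]_m.+2 :=
  \row_n (if n \in D then v 0 n else a 0 n).

Definition cube (l r : R) : set 'rV[R]_m.+2 :=
  [set y | forall n, l <= y 0 n <= r].

Definition boxes (l r : R) : set ('rV[R]_m.+2 * 'rV[R]_m.+2) :=
  [set ab | [/\ cube l r ab.1, cube l r ab.2 &
                forall n, ab.1 0 n <= ab.2 0 n]].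

(* A system K a b of conditional laws of X1 given
   Y_1 \in [a_1, b_1], ..., Y_N \in [a_N, b_N], where a_n = b_n means
   conditioning on the value of Y_n: for every set D of coordinates,
   substituting (Y_n)_(n in D) for both corners yields a regular conditional
   law of X1 given (Y_n)_(n in D), on the event that the remaining signals lie
   in their intervals. D = set0 is elementary conditioning on a box. *)
Definition box_cond_law (l r : R) (X1 : {RV P >-> R}) Y
    (K : 'rV[R]_m.+2 -> 'rV[R]_m.+2 -> probability R R) :=
  forall (D : {set 'I_m.+2}) (a b : 'rV[R]_m.+2) (B : 'I_m.+2 -> set R),
    boxes l r (a, b) ->
    (forall n, measurable (B n) /\ B n `<=` `[l, r]) ->
    let y w := \row_n Y n w in
    let KY w := K (splice D (y w) a) (splice D (y w) b) in
    let G := [set w | forall n,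
                if n \in D then B n (Y n w) else a 0 n <= Y n w <= b 0 n] in
    forall A : set R, measurable A ->
      measurable_fun G (fun w => KY w A : \bar R) /\
      P (G `&` X1 @^-1` A) = (\int[P]_(w in G) KY w A)%E.

Definition box_exp (K : 'rV[R]_m.+2 -> 'rV[R]_m.+2 -> probability R R)
    (h : R -> R) (a b : 'rV[R]_m.+2) : R := \int[K a b]_x h x.

Definition box_exp_exists (K : 'rV[R]_m.+2 -> 'rV[R]_m.+2 -> probability R R)
    (h : R -> R) (a b : 'rV[R]_m.+2) :=
  (K a b).-integrable setT (EFin \o h).

Definition positive_dependence (l r : R)
    (K : 'rV[R]_m.+2 -> 'rV[R]_m.+2 -> probability R R) :=
  forall h : R -> R, {homo h : x y / x < y} ->
  forall (n : 'I_m.+2) (a b a' b' : 'rV[R]_m.+2),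
    boxes l r (a, b) -> boxes l r (a', b') ->
    (forall k, k != n -> a' 0 k = a 0 k /\ b' 0 k = b 0 k) ->
    (a 0 n < a' 0 n /\ b' 0 n = b 0 n) \/ (a' 0 n = a 0 n /\ b 0 n < b' 0 n) ->
    box_exp_exists K h a b -> box_exp_exists K h a' b' ->
    if n == ord0 then box_exp K h a b < box_exp K h a' b'
    else box_exp K h a b <= box_exp K h a' b'.

Definition box_continuity (l r : R)
    (K : 'rV[R]_m.+2 -> 'rV[R]_m.+2 -> probability R R) :=
  forall h : R -> R, continuous h ->
  {within [set ab | boxes l r ab /\ box_exp_exists K h ab.1 ab.2],
    continuous (fun ab => box_exp K h ab.1 ab.2)}.

(* KZ y z is the conditional law of X1 given Y_1 = y and Z_1 = z. A regular
   conditional law is determined only almost everywhere, whereas its values on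
   the null set y = z are needed below; weak continuity singles out one version
   on [l, r] x [l, r]. *)
Definition Z1_cond_law (l r : R) (X1 : {RV P >-> R}) Y
    (KZ : R -> R -> probability R R) :=
  (forall B B' : set R, measurable B -> measurable B' ->
    B `<=` `[l, r] -> B' `<=` `[l, r] ->
    let KYZ w := KZ (Y ord0 w) (Z1 Y w) in
    let G := [set w | B (Y ord0 w) /\ B' (Z1 Y w)] in
    forall A : set R, measurable A ->
      measurable_fun G (fun w => KYZ w A : \bar R) /\
      P (G `&` X1 @^-1` A) = (\int[P]_(w in G) KYZ w A)%E) /\
  (forall h : R -> R, continuous h ->
    {within [set yz : R * R | [/\ l <= yz.1 <= r, l <= yz.2 <= r &
                 (KZ yz.1 yz.2).-integrable setT (EFin \o h)]],
      continuous (fun yz : R * R => \int[KZ yz.1 yz.2]_x h x)}).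

End Auction.

Section Contract.
Context d (T : measurableType d) (R : realType) (P : probability T R).
Variables (m : nat) (X Y : 'I_m.+2 -> {RV P >-> R}).
Variables (KZ : R -> R -> probability R R) (u c : R -> R) (el er : R).

Definition best_effort (alpha e : R) :=
  el <= e <= er /\
  forall e', el <= e' <= er -> (1 - alpha) * e' - c e' <= (1 - alpha) * e - c e.

Definition effort (alpha : R) : R := xget el [set e | best_effort alpha e].

Definition kappa (alpha : R) : R :=
  (1 - alpha) * effort alpha - c (effort alpha).

Definition win_utility (alpha b x : R) : R :=
  u ((1 - alpha) * (x - b) + kappa alpha).

Definition zero_utility_bid (alpha y z b : R) :=
  \int[KZ y z]_x win_utility alpha b x = 0.

Definition tbid (alpha y z : R) : R :=
  xget 0 [set b | unique (zero_utility_bid alpha y z) b].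

Definition bid (alpha : R) (w : T) (n : 'I_m.+2) : R :=
  tbid alpha (Y n w) (Y n w).

Definition wins (alpha : R) (w : T) (n : 'I_m.+2) : bool :=
  max_others (bid alpha w) n < bid alpha w n.

(* The winner n pays the second highest bid b, and then alpha (x + e - b). On
   the event of a tie at the top (of probability 0) nothing is collected. *)
Definition seller_receipts (alpha : R) (w : T) : R :=
  \sum_(n < m.+2 | wins alpha w n)
    let b := max_others (bid alpha w) n in
    b + alpha * (X n w + effort alpha - b).

Definition revenue (alpha : R) : R := \int[P]_w seller_receipts alpha w.

Definition revenue_formula (alpha : R) : R :=
  cond_expectation P [set w | Z1 Y w < Y ord0 w]
    (fun w => alpha * X ord0 w + alpha * effort alpha +
              (1 - alpha) * tbid alpha (Z1 Y w) (Z1 Y w)).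

Definition right_derivative_at0 (f : R -> R) (D : R) :=
  (f a - f 0) / a @[a --> 0^'+] --> D.

End Contract.

(* Main.v *)
(* Put [s(alpha, z) = (1 - alpha) t(alpha, z, z) - kappa(alpha)], so that
   E[u((1 - alpha) X_1 - s) | Y_1 = Z_1 = z] = 0: the effort disappears from this
   equation.  Concavity of [u] makes [s] concave in [alpha], hence its slope
   [q(alpha, z) = (s(alpha, z) - s(0, z)) / alpha] is nonincreasing in [alpha], and
   Jensen's inequality gives [q(alpha, z) >= - E[X_1 | Y_1 = Z_1 = z]].  The difference
   quotient of the revenue at 0 is
     E[X_1 + q(alpha, Z_1) | Y_1 > Z_1] + e(alpha) + (kappa(alpha) - kappa(0)) / alpha.
   The effort terms vanish in the limit by the envelope theorem, and the rest increases,
   as [alpha] decreases to 0, to a limit which is at least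
     E[X_1 - E[X_1 | Y_1 = Z_1 = z]_(z = Z_1) | Y_1 > Z_1],
   and this is positive because E[X_1 | Y_1 = y, Z_1 = z] increases with [y].
   That monotonicity, and the one of the bids, comes from positive dependence once the
   law of [X_1] given [Y_1 = y, Z_1 = z] is recognised as a conditional law on a box. *)

Require Import Defs.
From mathcomp Require Import giry lra ring.

Set Implicit Arguments.
Unset Strict Implicit.
Unset Printing Implicit Defensive.

(** * Concave functions *)

(** The bids depend on the laws of [X_1] given [Y_1 = Z_1 = z], that is on a null set, and [KZ] is
    tied to the box laws [K] only through integrals. Both are continuous in their parameters, so
    they are compared through averages of [h (X_1)] over thin events [a <= Y_1 <= b],
    [z1 < Z_1 <= z] of positive probability. Such an event is not a box: it is cut into boxes
    according to the first opponent above [z1], and symmetry makes all of these shrink to the same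
    degenerate box. The cutting takes place at levels [yl < z1 < z], which is why bids are studied
    for [z] in []yl, yr]]; the signals avoid [yl] almost surely. Compactness of the range of [X_1]
    has to be passed on to every conditional law, again by continuity. After that every continuous
    function is integrable, and the slopes in [alpha] are bounded uniformly in [z]. The derivative
    then exists because a bounded monotone function has a limit, and positivity at a single [alpha]
    bounds this limit away from 0. *)

Lemma convex_functionE (R : realType) (D : set R) (f : R -> R) :
  convex_function D f -> forall t x y, 0 <= t <= 1 -> D x -> D y ->
    f (t * x + (1 - t) * y) <= t * f x + (1 - t) * f y.
Proof.
move=> cf t x y /andP[t0 t1] Dx Dy.
exact: (cf (Itv01 t0 t1) x y (mem_set Dx) (mem_set Dy)).
Qed.

Lemma concave_functionE (R : realType) (u : R -> R) :
  concave_function u -> forall t x y, 0 <= t <= 1 ->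
    t * u x + (1 - t) * u y <= u (t * x + (1 - t) * y).
Proof.
move=> cu t x y t01; have := convex_functionE cu t01 (I : setT x) (I : setT y).
rewrite /=; lra.
Qed.

(** Within distance 1 of [x], the slopes of chords through [x] lie between those of the unit chords
    on either side, which gives a Lipschitz bound at [x] with constant [M]. The sign [s] treats both
    directions at once, and the final [+ 1] makes [M] positive for the division [e / M]. *)
Lemma concave_continuous (R : realType) (u : R -> R) :
  concave_function u -> continuous u.
Proof.
move=> cu x.
pose M := `|u (x + 1) - u x| + `|u x - u (x - 1)| + 1.
have M0 : 0 < M by rewrite /M ltr_wpDl// addr_ge0.
have key (s t : R) : s ^+ 2 = 1 -> 0 <= t <= 1 -> `|u (x + s * t) - u x| <= t * M.
  move=> s1 /andP[t0 t1].
  have t01 : 0 <= t <= 1 by rewrite t0.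
  have h1 := concave_functionE cu (x + s) x t01.
  (* The weight with which [x] is a convex combination of [x + s * t] and [x - s]. *)
  have tt : 0 <= (1 + t)^-1 <= 1 by rewrite invr_ge0 invf_le1; lra.
  have h2 := concave_functionE cu (x + s * t) (x - s) tt.
  have e2 : (1 + t)^-1 * (x + s * t) + (1 - (1 + t)^-1) * (x - s) = x.
    by field; lra.
  have e1 : t * (x + s) + (1 - t) * x = x + s * t by ring.
  rewrite e1 in h1; rewrite e2 in h2.
  have h3 : u (x + s * t) + t * u (x - s) <= (1 + t) * u x.
    have := ler_wpM2l (_ : 0 <= 1 + t) h2.
    rewrite mulrDr !mulrA mulrBr mulfV; last lra.
    by rewrite mulr1 mul1r; move/(_ ltac:(lra)); lra.
  have ms : u (x + s) - u x >= - M /\ u x - u (x - s) <= M.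
    have s11 : (s == 1) || (s == -1) by rewrite -sqrf_eq1 s1.
    move: (ler_norm (u (x+1) - u x)) (ler_norm (u x - u (x + 1)))
      (ler_norm (u x - u (x - 1))) (ler_norm (u (x-1) - u x)).
    rewrite (distrC (u x) (u (x + 1))) (distrC (u (x - 1)) (u x)).
    rewrite /M; case/orP : s11 => /eqP ->; rewrite ?opprK; split; lra.
  have [m1 m2] := ms.
  rewrite ler_norml; apply/andP; split.
    suff : t * (u (x + s) - u x) >= t * (- M) by lra.
    by rewrite ler_wpM2l.
  suff : t * (u x - u (x - s)) <= t * M by lra.
  by rewrite ler_wpM2l.
apply/cvgrPdist_le => e e0.
near=> y.
have d1 : `|y - x| <= 1.
  by rewrite distrC; near: y; apply: cvgr_dist_le.
have d2 : `|y - x| <= e / M.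
  by rewrite distrC; near: y; apply: cvgr_dist_le; rewrite ?divr_gt0.
have [s s1 ye] : exists2 s : R, s ^+ 2 = 1 & y = x + s * `|y - x|.
  have [h|h] := leP x y.
    by exists 1; rewrite ?expr1n// ger0_norm ?subr_ge0//; ring.
  by exists (-1); rewrite ?sqrrN ?expr1n// ltr0_norm ?subr_lt0//; ring.
rewrite distrC {1}ye (le_trans (key _ _ s1 _)) ?normr_ge0//.
by rewrite -ler_pdivlMr.
Unshelve. all: by end_near. Qed.

(** * Optimal effort *)

Section Effort.
Context {R : realType} (c : R -> R) (el er : R).
Hypothesis c_convex : convex_function (`[el, er]%classic : set R) c.
Hypothesis effort_unique : forall alpha, 0 <= alpha < 1 ->
     exists! e, best_effort c el er alpha e.

Let zero01 : (0 : R) <= (0 : R) < 1. Proof. by rewrite lexx ltr01. Qed.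

Lemma effortP alpha : 0 <= alpha < 1 ->
  best_effort c el er alpha (effort c el er alpha).
Proof.
by move=> /effort_unique[e [be _]]; exact: (xgetPex el (ex_intro _ e be)).
Qed.

(** Comparing the two optimality conditions gives [e(alpha) <= e(0)], and shows that [e - c e] is at
    [e(alpha)] at most [alpha * (e(0) - e(alpha))] below its maximum. By convexity of [c], an effort
    below [e(0) - eps] would lose at least as much as [e(0) - eps] does, an amount [dl] which
    uniqueness at [alpha = 0] makes positive. *)
Lemma effort_cvg0 : effort c el er alpha @[alpha --> 0^'+] --> effort c el er 0.
Proof.
have [/andP[le0 e0r] opt0] := effortP zero01.
set e0 := effort c el er 0 in le0 e0r opt0 *.
apply/cvgrPdist_le => eps eps0.
have [le0e|] := leP (e0 - eps) el.
  near=> alpha.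
  have a01 : 0 <= alpha < 1 by apply/andP; split; near: alpha;
    [exact: nbhs_right_ge|exact: nbhs_right_lt].
  have a0 : 0 < alpha by near: alpha; exact: nbhs_right_gt.
  have [/andP[lea ear] opta] := effortP a01.
  set ea := effort c el er alpha in lea ear opta *.
  have h1 := opta e0 ltac:(by rewrite le0).
  have h2 := opt0 ea ltac:(by rewrite lea).
  have : ea <= e0 by rewrite -(ler_pM2l a0); lra.
  by move=> eae; rewrite ger0_norm; lra.
move=> le0e.
have inx : el <= e0 - eps <= er by lra.
pose dl := e0 - c e0 - ((e0 - eps) - c (e0 - eps)).
have dl0 : 0 < dl.
  rewrite /dl subr_gt0 lt_neqAle; apply/andP; split; last first.
    by have := opt0 _ inx; lra.
  apply/eqP => E; have [e [be ue]] := effort_unique zero01.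
  have b2 : best_effort c el er 0 (e0 - eps).
    by split=> // e' /opt0; lra.
  have b1 : best_effort c el er 0 e0 by split=> //; rewrite le0.
  by have := ue _ b2; have := ue _ b1; lra.
near=> alpha.
have a01 : 0 <= alpha < 1 by apply/andP; split; near: alpha;
    [exact: nbhs_right_ge|exact: nbhs_right_lt].
have a0 : 0 < alpha by near: alpha; exact: nbhs_right_gt.
have adl : alpha * (er - el + 1) < dl.
  rewrite -ltr_pdivlMr; last lra.
  by near: alpha; apply: nbhs_right_lt; rewrite divr_gt0//; lra.
have [/andP[lea ear] opta] := effortP a01.
set ea := effort c el er alpha in lea ear opta *.
have h1 := opta e0 ltac:(by rewrite le0).
have h2 := opt0 ea ltac:(by rewrite lea).
have eae0 : ea <= e0 by rewrite -(ler_pM2l a0); lra.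
rewrite ger0_norm ?subr_ge0//.
rewrite leNgt; apply/negP => far.
have gap : alpha * (e0 - ea) < dl.
  by apply: le_lt_trans adl; rewrite ler_wpM2l ?ltW//; lra.
pose t := eps / (e0 - ea).
have t01 : 0 <= t <= 1.
  by rewrite /t divr_ge0//= ?ler_pdivrMr; lra.
have := convex_functionE c_convex t01 (_ : `[el, er]%classic ea)
  (_ : `[el, er]%classic e0).
rewrite /= !in_itv /= lea ear le0 e0r => /(_ erefl erefl).
have -> : t * ea + (1 - t) * e0 = e0 - eps by rewrite /t; field; lra.
move=> cc.
have : t * (e0 - c e0 - (ea - c ea)) < dl.
  apply: le_lt_trans gap; apply: (@le_trans _ _ (e0 - c e0 - (ea - c ea))).
    by case/andP: t01 => _ t1; rewrite ler_piMl//; lra.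
  by lra.
have te : t * (e0 - ea) = eps by rewrite /t; field; lra.
rewrite /dl; lra.
Unshelve. all: try by end_near. Qed.

(** Testing each maximiser in the other problem gives [- e(0) <= (kappa(alpha) - kappa(0)) / alpha
    <= - e(alpha)], so the sum lies between [e(alpha) - e(0)] and 0. *)
Lemma envelope_cvg0 :
  effort c el er alpha + (kappa c el er alpha - kappa c el er 0) / alpha
    @[alpha --> 0^'+] --> 0.
Proof.
apply: (@squeeze_cvgr _ _ _ _ (fun alpha => effort c el er alpha - effort c el er 0)
  (fun _ => 0)).
- near=> alpha.
  have a01 : 0 <= alpha < 1 by apply/andP; split; near: alpha;
    [exact: nbhs_right_ge|exact: nbhs_right_lt].
  have a0 : 0 < alpha by near: alpha; exact: nbhs_right_gt.
  have [ba opta] := effortP a01.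
  have [b0 opt0] := effortP zero01.
  have h1 := opta _ b0; have h2 := opt0 _ ba.
  rewrite lerD2l /kappa -lerBrDl sub0r; apply/andP; split.
    by rewrite ler_pdivlMr//; lra.
  by rewrite ler_pdivrMr//; lra.
- rewrite -[X in _ --> X](subrr (effort c el er 0)).
  by apply: cvgB; [exact: effort_cvg0|exact: cvg_cst].
- exact: cvg_cst.
Unshelve. all: by end_near. Qed.

End Effort.

(** * Certainty equivalents under a compactly carried law *)

Section RintegralLemmas.
Context d (T : measurableType d) (R : realType) (mu : {measure set T -> \bar R}).

Lemma Rintegral_gt0 (D : set T) (f : T -> R) : measurable D -> (0 < mu D)%E ->
  mu.-integrable D (EFin \o f) -> (forall x, D x -> 0 < f x) ->
  0 < \int[mu]_(x in D) f x.
Proof.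
move=> mD muD intf f0; rewrite lt_neqAle Rintegral_ge0 ?andbT; last first.
  by move=> x /f0 /ltW.
apply/eqP => /esym E.
have mf := measurable_int _ intf.
have : (\int[mu]_(x in D) `|(EFin \o f) x| = 0)%E.
  have /fineK <- : (\int[mu]_(x in D) `|(EFin \o f) x|)%E \is a fin_num.
    by apply: integrable_fin_num => //; exact: integrable_abse.
  rewrite -[0%E]/(0%:E) -E; congr (fine _)%:E.
  by apply: eq_integral => x /set_mem Dx; rewrite gee0_abs// lee_fin ltW// f0.
move/ae_eq_integral_abs => /(_ mD mf) [N [mN N0 DN]].
suff : (mu D <= 0)%E by rewrite leNgt muD.
rewrite -N0 le_measure ?inE// => x Dx; apply: DN => /= /(_ Dx) [fx0].
by have := f0 _ Dx; rewrite fx0 ltxx.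
Qed.

Lemma lt_Rintegral (D : set T) (f g : T -> R) : measurable D -> (0 < mu D)%E ->
  mu.-integrable D (EFin \o f) -> mu.-integrable D (EFin \o g) ->
  (forall x, D x -> f x < g x) ->
  \int[mu]_(x in D) f x < \int[mu]_(x in D) g x.
Proof.
move=> mD muD intf intg fg; rewrite -subr_gt0 -RintegralB//.
apply: Rintegral_gt0 => //; last by move=> x /fg; rewrite subr_gt0.
by rewrite -[X in _.-integrable _ X]/((EFin \o g) \- (EFin \o f))%E; exact: integrableB.
Qed.

Lemma Rintegral_setDnull (D N : set T) (f : T -> R) :
  measurable D -> measurable N -> mu.-integrable D (EFin \o f) -> mu N = 0%E ->
  \int[mu]_(x in D) f x = \int[mu]_(x in D `\` N) f x.
Proof. by move=> mD mN intf N0; congr fine; exact: negligible_integral. Qed.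

End RintegralLemmas.

(** Chords from the origin to the left are at least as steep as those to the right, so the supremum
    of the latter slopes gives a line above the graph; it is at least [u 1 > 0]. Jensen's inequality
    is thereby reduced to integrating a linear bound. *)
Lemma concave_supporting_line (R : realType) (u : R -> R) :
  concave_function u -> {homo u : x y / x < y} -> u 0 = 0 ->
  exists2 p, 0 < p & forall x, u x <= p * x.
Proof.
move=> cu iu u0.
have slope y z : y < 0 -> 0 < z -> u z / z <= u y / y.
  move=> y0 z0.
  have zy : 0 < z - y by lra.
  have t01 : 0 <= - y / (z - y) <= 1.
    by rewrite divr_ge0 ?ler_pdivrMr ?mul1r//; lra.
  have := concave_functionE cu z y t01.
  have -> : - y / (z - y) * z + (1 - - y / (z - y)) * y = 0 by field; lra.
  have -> : - y / (z - y) * u z + (1 - - y / (z - y)) * u y =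
      (z * u y - y * u z) / (z - y) by field; lra.
  rewrite u0 ler_pdivrMr// mul0r => h.
  by rewrite ler_pdivrMr// mulrAC ler_ndivlMr//; lra.
pose A := [set u z / z | z in [set z | 0 < z]].
have hub : has_ubound A.
  by exists (u (-1) / (-1)) => _ [z z0 <-]; apply: slope => //; lra.
have ubA z : 0 < z -> u z / z <= sup A.
  by move=> z0; apply: ub_le_sup => //; exists z.
exists (sup A).
  apply: lt_le_trans (ubA 1 ltr01).
  by rewrite divr1 -[ltLHS]u0 iu.
move=> x; have [x0|x0|->] := ltgtP x 0; last by rewrite u0 mulr0.
  rewrite -ler_ndivlMr//; apply: ge_sup.
    by exists (u 1 / 1); exists 1 => //=; exact: ltr01.
  by move=> _ [z z0 <-]; exact: slope.
by rewrite -ler_pdivrMr// ubA.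
Qed.

Section CompactlyCarried.
Context {R : realType} (nu : probability R R) (xl xr : R).
Hypothesis nu_carried : nu `[xl, xr]%classic = 1%E.
Let I : set R := `[xl, xr]%classic.

Let mI : measurable I. Proof. exact: measurable_itv. Qed.
Let nuI : nu I = 1%E. Proof. exact: nu_carried. Qed.

Lemma carried_setC : nu (~` `[xl, xr]%classic) = 0%E.
Proof. by rewrite probability_setC ?nu_carried ?subee. Qed.

Lemma carried_le_bounds : xl <= xr.
Proof.
rewrite leNgt; apply/negP => h; have := nu_carried.
by rewrite set_itv_ge ?measure0 -?ltNge// => /eqP; rewrite eqe eq_sym oner_eq0.
Qed.

Lemma carried_integrable_I (h : R -> R) : continuous h -> nu.-integrable I (EFin \o h).
Proof.
move=> ch; apply: measurable_bounded_integrable => //.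
- by rewrite [X in (X < _)%E]nuI ltry.
- by apply: measurable_funTS; exact: continuous_measurable_fun.
- have /compact_bounded [M [Mr HM]] : compact (h @` I).
    by apply: continuous_compact; [exact: continuous_subspaceT|exact: segment_compact].
  by exists M; split => // x /HM hx y Iy; apply: hx; exists y.
Qed.

Lemma carried_integrable (h : R -> R) : continuous h -> nu.-integrable setT (EFin \o h).
Proof.
move=> ch; have mh : measurable_fun setT (EFin \o h).
  by apply/measurable_EFinP; exact: continuous_measurable_fun.
apply/(negligible_integrable (measurableC mI) measurableT mh carried_setC).
by rewrite setDE setCK setTI; exact: carried_integrable_I.
Qed.

Lemma carried_Rintegral (h : R -> R) : continuous h ->
  \int[nu]_x h x = \int[nu]_(x in I) h x.
Proof.
move=> ch.
rewrite (Rintegral_setDnull measurableT (measurableC mI) (carried_integrable ch) carried_setC).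
by rewrite setDE setCK setTI.
Qed.

Lemma carried_le (h g : R -> R) : continuous h -> continuous g ->
  (forall x, xl <= x <= xr -> h x <= g x) -> \int[nu]_x h x <= \int[nu]_x g x.
Proof.
move=> ch cg hg; rewrite !carried_Rintegral//; apply: le_Rintegral => //.
- exact: carried_integrable_I.
- exact: carried_integrable_I.
Qed.

Lemma carried_lt (h g : R -> R) : continuous h -> continuous g ->
  (forall x, xl <= x <= xr -> h x < g x) -> \int[nu]_x h x < \int[nu]_x g x.
Proof.
move=> ch cg hg; rewrite !carried_Rintegral//; apply: lt_Rintegral => //.
- by rewrite [X in (_ < X)%E]nuI lte01.
- exact: carried_integrable_I.
- exact: carried_integrable_I.
Qed.

Lemma carried_cst (k : R) : \int[nu]_x k = k.
Proof. by rewrite Rintegral_cst// [X in fine X](probability_setT nu) mulr1. Qed.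

Lemma carried_lincomb (h g : R -> R) (a b : R) : continuous h -> continuous g ->
  \int[nu]_x (a * h x + b * g x) = a * \int[nu]_x h x + b * \int[nu]_x g x.
Proof.
move=> ch cg.
have cM (k : R) (f : R -> R) : continuous f -> continuous (fun x => k * f x).
  by move=> cf x; apply: cvgM; [exact: cvg_cst|exact: cf].
by rewrite RintegralD// ?RintegralZl//; apply: carried_integrable => //; exact: cM.
Qed.

Context (u : R -> R).
Hypothesis u_concave : concave_function u.
Hypothesis u_incr : {homo u : x y / x < y}.
Hypothesis u0 : u 0 = 0.

(** With [k = 1 - alpha] and [s = (1 - alpha) * b - kappa(alpha)] this is the utility of the winner
    at nominal value [x]. The argument of [u] is affine in [(k, s)], so the mean utility is jointly
    concave in this pair; both the Jensen bound and the monotone slopes come from that. *)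
Definition util (k s x : R) := u (k * x - s).

Lemma util_continuous k s : continuous (util k s).
Proof.
move=> x; apply: (@continuous_comp _ _ _ (fun x => k * x - s) u); last exact: concave_continuous.
by apply: cvgB; [apply: cvgM; [exact: cvg_cst|exact: cvg_id]|exact: cvg_cst].
Qed.

Definition mean_util (k s : R) := \int[nu]_x util k s x.

Lemma mean_util_decr k s s' : s < s' -> mean_util k s' < mean_util k s.
Proof.
move=> ss'; apply: carried_lt => [||x _]; try exact: util_continuous.
by apply: u_incr; lra.
Qed.

Lemma mean_util_inj k s s' : mean_util k s = 0 -> mean_util k s' = 0 -> s = s'.
Proof.
move=> h h'; case: (ltgtP s s') => // /(mean_util_decr k); rewrite h h' ltxx //.
Qed.

Lemma mean_util_le k s s' : 0 <= mean_util k s -> mean_util k s' = 0 -> s <= s'.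
Proof.
move=> h h'; rewrite leNgt; apply/negP => /(mean_util_decr k).
by rewrite h' ltNge h.
Qed.

Lemma mean_util_concave t k k' s s' : 0 <= t <= 1 ->
  t * mean_util k s + (1 - t) * mean_util k' s' <=
  mean_util (t * k + (1 - t) * k') (t * s + (1 - t) * s').
Proof.
move=> t01; rewrite -carried_lincomb; try exact: util_continuous.
apply: carried_le => [||x _].
- move=> x; apply: cvgD; apply: cvgM; try exact: cvg_cst; exact: util_continuous.
- exact: util_continuous.
rewrite /util; have := concave_functionE u_concave (k * x - s) (k' * x - s') t01.
by congr (_ <= u _); ring.
Qed.

Lemma mean_util_root k : 0 <= k -> exists2 s, k * xl <= s <= k * xr & mean_util k s = 0.
Proof.
move=> k0.
(* Concavity in [s] on the whole line gives continuity without a limit under the integral. *)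
have cont : continuous (mean_util k).
  apply: concave_continuous => t x y _ _.
  have t01 : 0 <= t%:num <= 1 by rewrite ge0 le1.
  have := mean_util_concave k k x y t01.
  rewrite -mulrDl addrCA subrr addr0 mul1r => h.
  suff : - mean_util k (t%:num * x + (1 - t%:num) * y) <=
    t%:num * - mean_util k x + (1 - t%:num) * - mean_util k y by [].
  lra.
have lo : 0 <= mean_util k (k * xl).
  rewrite -(carried_cst 0); apply: carried_le => [|//|x /andP[x1 _]].
  - exact: cst_continuous.
  - exact: util_continuous.
  - rewrite -u0 /util -mulrBr; have [->//|/eqP ne] := eqVneq (k * (x - xl)) 0.
    by apply/ltW/u_incr; rewrite lt_neqAle eq_sym; apply/andP; split;
      [exact/eqP|rewrite mulr_ge0// subr_ge0].
have hi : mean_util k (k * xr) <= 0.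
  rewrite -[leRHS](carried_cst 0); apply: carried_le => [|//|x /andP[_ x1]].
  - exact: util_continuous.
  - exact: cst_continuous.
  - rewrite -u0 /util -mulrBr; have [->//|/eqP ne] := eqVneq (k * (x - xr)) 0.
    by apply/ltW/u_incr; rewrite lt_neqAle; apply/andP; split;
      [exact/eqP|rewrite mulr_ge0_le0// subr_le0].
have le : k * xl <= k * xr by rewrite ler_wpM2l// carried_le_bounds.
have [||s] := IVT le (_ : {within `[k * xl, k * xr], continuous (mean_util k)}) (v := 0).
- exact: continuous_subspaceT.
- by rewrite ge_min le_max hi lo orbT.
by rewrite in_itv /= => sin E; exists s.
Qed.

(* Jensen's inequality applied twice: [(1 - al) X + al E X] is a mean-preserving
   contraction of [X]. *)
Lemma mean_util_root_Jensen al s0 s : 0 <= al <= 1 ->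
  mean_util 1 s0 = 0 -> mean_util (1 - al) s = 0 ->
  s0 - al * \int[nu]_x x <= s.
Proof.
move=> al01 E0 Es; set m := \int[nu]_x x.
have um : 0 <= u (m - s0).
  have m0 : 0 <= m - s0.
    have [p p0 up] := concave_supporting_line u_concave u_incr u0.
    rewrite -(pmulr_rge0 _ p0) -E0.
    have -> : p * (m - s0) = p * m + - (p * s0) * \int[nu]_x 1.
      by rewrite carried_cst; ring.
    rewrite -carried_lincomb; [|by move=> x; exact: cvg_id|exact: cst_continuous].
    apply: carried_le => [||x _].
    - exact: util_continuous.
    - by move=> x; apply: cvgD; apply: cvgM; try exact: cvg_cst; exact: cvg_id.
    - by rewrite /util mul1r (le_trans (up _))//; lra.
  by move: m0; rewrite le_eqVlt => /orP[/eqP <-|/u_incr/ltW]; rewrite u0.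
apply: mean_util_le Es.
have t01 : 0 <= 1 - al <= 1 by lra.
(* At [k = 0] the lottery is degenerate, with utility [u (m - s0)]. The segment from [(1, s0)] to
   [(0, s0 - m)] passes through [(1 - al, s0 - al * m)], where the mean utility is therefore
   nonnegative. *)
have := mean_util_concave 1 0 s0 (s0 - m) t01.
have -> : mean_util 0 (s0 - m) = u (m - s0).
  rewrite /mean_util /util -[RHS]carried_cst; apply: eq_Rintegral => x _.
  by congr u; ring.
rewrite E0 mulr0 add0r.
have -> : (1 - al) * 1 + (1 - (1 - al)) * 0 = 1 - al by ring.
have -> : (1 - al) * s0 + (1 - (1 - al)) * (s0 - m) = s0 - al * m by ring.
by apply: le_trans; rewrite mulr_ge0//; lra.
Qed.

(** [1 - be] lies between [1 - al] and [1], with weight [be / al] on the former. By joint concavity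
    the mean utility at the interpolated [s] is nonnegative, so the root [sb] is at least that
    value. *)
Lemma mean_util_root_concave al be s0 sa sb : 0 < be <= al ->
  mean_util 1 s0 = 0 -> mean_util (1 - al) sa = 0 -> mean_util (1 - be) sb = 0 ->
  (sa - s0) / al <= (sb - s0) / be.
Proof.
move=> /andP[be0 beal] E0 Ea Eb.
have al0 : 0 < al by lra.
have t01 : 0 <= be / al <= 1 by rewrite divr_ge0 ?ler_pdivrMr ?mul1r//; lra.
have := mean_util_concave (1 - al) 1 sa s0 t01.
rewrite Ea E0 !mulr0 addr0.
have -> : be / al * (1 - al) + (1 - be / al) * 1 = 1 - be by field; lra.
move=> /mean_util_le /(_ Eb) h.
rewrite ler_pdivlMr// mulrAC -mulrA mulrC.
lra.
Qed.

(** On the carrier [al * x] lies between [al * xl] and [al * xr], which allows a pointwise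
    comparison with the case [al = 0]. The resulting bounds on the slope in [al] do not depend on
    [nu], hence will be uniform in [z]. *)
Lemma mean_util_root_bounds al s0 s : 0 <= al ->
  mean_util 1 s0 = 0 -> mean_util (1 - al) s = 0 ->
  s0 - al * xr <= s <= s0 - al * xl.
Proof.
move=> al0 E0 Es.
have w x y : x <= y -> u x <= u y.
  by rewrite le_eqVlt => /orP[/eqP ->//|/u_incr/ltW].
have mono : {homo *%R al : x y / x <= y} by move=> x y; exact: ler_wpM2l.
apply/andP; split.
  apply: mean_util_le Es; rewrite -E0.
  apply: carried_le => [||x /andP[_ /mono h]]; try exact: util_continuous.
  by apply: w; lra.
have -> : s0 - al * xl = - (al * xl - s0) by ring.
rewrite leNgt; apply/negP => /(mean_util_decr (1 - al)); rewrite Es -E0 ltNge => /negP; apply.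
apply: carried_le => [||x /andP[/mono h _]]; try exact: util_continuous.
by apply: w; lra.
Qed.

End CompactlyCarried.

(** * Joint densities *)

Lemma ge0_integral_gt0 d (T : measurableType d) (R : realType)
    (mu : {measure set T -> \bar R}) (D : set T) (G : T -> \bar R) :
  measurable D -> (0 < mu D)%E -> measurable_fun setT G ->
  (forall x, 0 <= G x)%E -> (forall x, D x -> 0 < G x)%E ->
  (0 < \int[mu]_x G x)%E.
Proof.
move=> mD muD mG G0 GD.
rewrite lt_neqAle integral_ge0// andbT; apply/eqP => /esym E.
have : (\int[mu]_x `|G x| = 0)%E.
  by rewrite -E; apply: eq_integral => x _; rewrite gee0_abs.
move/ae_eq_integral_abs => /(_ measurableT mG) [N [mN N0 DN]].
suff : (mu D <= 0)%E by rewrite leNgt muD.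
rewrite -N0 le_measure ?inE// => x Dx; apply: DN => /= /(_ I) Gx0.
by have := GD _ Dx; rewrite Gx0 ltxx.
Qed.

Section IterIntegral.
Context {R : realType}.

Lemma iter_integral0 n (F : n.-tuple R -> \bar R) :
  (forall t, F t = 0%E) -> iter_integral F = 0%E.
Proof.
elim: n F => [|n IHn] F F0 /=; first exact: F0.
by apply: integral0_eq => x _; apply: IHn => t; exact: F0.
Qed.

Lemma iter_integral_ge0 n (F : n.-tuple R -> \bar R) :
  (forall t, 0 <= F t)%E -> (0 <= iter_integral F)%E.
Proof.
elim: n F => [|n IHn] F F0 /=; first exact: F0.
by apply: integral_ge0 => x _; apply: IHn => t; exact: F0.
Qed.

Lemma measurable_iter_integral n d (S : measurableType d)
    (F : S * n.-tuple R -> \bar R) :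
  measurable_fun setT F -> (forall z, 0 <= F z)%E ->
  measurable_fun setT (fun s => iter_integral (fun t => F (s, t))).
Proof.
elim: n d S F => [|n IHn] d S F mF F0 /=.
  by apply: measurableT_comp mF _; apply: measurable_fun_pair.
pose G (z : S * R) := iter_integral (fun t : n.-tuple R => F (z.1, [tuple of z.2 :: t])).
have mG : measurable_fun setT G.
  apply: (IHn _ _ (fun z => F (z.1.1, [tuple of z.1.2 :: z.2]))) => //.
  apply: measurableT_comp mF _; apply: measurable_fun_pair => /=.
    exact: measurableT_comp measurable_fst measurable_fst.
  apply: (@measurable_cons _ _ _ R (fun z : S * R * n.-tuple R => z.1.2) n (fun z => z.2)).
    exact: measurableT_comp measurable_snd measurable_fst.
  exact: measurable_snd.
have G0 z : (0 <= G z)%E by exact: iter_integral_ge0.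
exact: (@measurable_fun_fubini_tonelli_F _ _ S _ R lebesgue_measure G mG G0).
Qed.

(** The corners are sequences over [nat] so that the induction can shift them once the first
    variable is fixed. The inner integral is positive for every first coordinate in [[a 0, b 0]], an
    interval of positive length. *)
Lemma iter_integral_gt0 n (F : n.-tuple R -> \bar R) (a b : nat -> R) :
  measurable_fun setT F -> (forall t, 0 <= F t)%E ->
  (forall i, (i < n)%N -> a i < b i) ->
  (forall t : n.-tuple R, (forall i, (i < n)%N -> a i <= nth 0 t i <= b i) -> (0 < F t)%E) ->
  (0 < iter_integral F)%E.
Proof.
elim: n F a b => [|n IHn] F a b mF F0 ab Fab /=; first exact: Fab.
have mF' : measurable_fun setT (fun z : R * n.-tuple R => F [tuple of z.1 :: z.2]).
  apply: measurableT_comp mF _.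
  apply: (@measurable_cons _ _ _ R (fun z : R * n.-tuple R => z.1) n (fun z => z.2)).
    exact: measurable_fst.
  exact: measurable_snd.
set G := fun x : R => _.
apply: (@ge0_integral_gt0 _ _ R lebesgue_measure `[a 0%N, b 0%N]%classic G).
- exact: measurable_itv.
- have := lebesgue_measure_itv `[a 0%N, b 0%N].
  by rewrite /= lte_fin ab// => ->; rewrite -EFinD lte_fin subr_gt0 ab.
- exact: (measurable_iter_integral mF').
- by move=> x; exact: iter_integral_ge0.
- move=> x; rewrite /= in_itv/= => xab.
  apply: (IHn _ (fun i => a i.+1) (fun i => b i.+1)) => //.
  + apply: measurableT_comp mF _.
    exact: (@measurable_cons _ _ _ R (fun=> x) n id).
  + by move=> i; exact: (ab i.+1).
  + by move=> t tab; apply: Fab => -[|i] //= ilt; exact: tab.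
Qed.

(** Once the variables before the [i]-th one are fixed, the remaining integral is over a single
    point of the line. *)
Lemma iter_integral_null_pt n (F : n.-tuple R -> \bar R) (i : nat) (c : R) :
  (i < n)%N -> (forall t : n.-tuple R, nth 0 t i != c -> F t = 0%E) ->
  iter_integral F = 0%E.
Proof.
elim: n F i => [//|n IHn] F [|i] ilt F0 /=; last first.
  by apply: integral0_eq => x _; apply: (IHn _ i) => // t tc; exact: F0.
set G := (fun x : R => _).
have -> : G = G \_ [set c].
  apply/funext => x; rewrite patchE; case: ifPn => //.
  rewrite notin_setE => /eqP xc; apply: iter_integral0 => t; exact: F0.
by rewrite -integral_mkcond integral_set1.
Qed.

(** Fixing the [i]-th variable to [x] leaves an integrand which vanishes unless the [j]-th variable
    equals [x]. *)
Lemma iter_integral_null_diag n (F : n.-tuple R -> \bar R) (i j : nat) :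
  (i < j < n)%N -> (forall t : n.-tuple R, nth 0 t i != nth 0 t j -> F t = 0%E) ->
  iter_integral F = 0%E.
Proof.
elim: n F i j => [|n IHn] F i j; first by rewrite ltn0 andbF.
case: i j => [|i] [|j] //= ijn F0; apply: integral0_eq => x _.
  apply: (iter_integral_null_pt (i := j) (c := x)) => // t tx.
  by apply: F0 => /=; rewrite eq_sym.
apply: (IHn _ i j) => // t tij; exact: (F0 [tuple of x :: t]).
Qed.

End IterIntegral.

Section Density.
Context d (T : measurableType d) (R : realType) (P : probability T R).
Context (n : nat) (Y : 'I_n -> {RV P >-> R}) (f : n.-tuple R -> R).
Hypothesis Yf : is_joint_density P Y f.

Lemma density_null_pt (i : 'I_n) (c : R) : P [set w | Y i w = c] = 0%E.
Proof.
have [mf f0 Pf] := Yf.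
pose B : set (n.-tuple R) := [set t | tnth t i = c].
have mB : measurable B.
  by have := @measurable_tnth _ R _ i measurableT _ (measurable_set1 c); rewrite setTI.
have := Pf _ mB; have -> : [set w | B [tuple Y i w | i < n]] = [set w | Y i w = c].
  by apply/seteqP; split => w; rewrite /B /= tnth_mktuple.
move=> ->; apply: (iter_integral_null_pt (i := i) (c := c)) => // t.
rewrite -tnth_nth => /eqP tc; rewrite indicE memNset ?mulr0//.
Qed.

Lemma density_null_diag (i j : 'I_n) : i != j -> P [set w | Y i w = Y j w] = 0%E.
Proof.
have [mf f0 Pf] := Yf => ij.
wlog {ij} ij : i j / (i < j)%N.
  move=> H; have [/H//|lt|/val_inj/eqP] := ltngtP i j; last by rewrite (negbTE ij).
  by rewrite (_ : [set _ | _] = [set w | Y j w = Y i w]) ?H//; apply/seteqP; split => w /=.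
pose B : set (n.-tuple R) := [set t | tnth t i = tnth t j].
have mB : measurable B.
  rewrite (_ : B = (fun t => tnth t i - tnth t j) @^-1` [set 0]).
    have /(_ measurableT _ (measurable_set1 0)) :=
      measurable_funB (@measurable_tnth _ R _ i) (@measurable_tnth _ R _ j).
    by rewrite setTI.
  by apply/seteqP; split => t /= => [->|/eqP]; rewrite ?subrr ?subr_eq0// => /eqP.
have := Pf _ mB; have -> : [set w | B [tuple Y i w | i < n]] = [set w | Y i w = Y j w].
  by apply/seteqP; split => w; rewrite /B /= !tnth_mktuple.
move=> ->; apply: (iter_integral_null_diag (i := i) (j := j)); first by rewrite ij/=.
move=> t; rewrite -!tnth_nth => /eqP tc; rewrite indicE memNset ?mulr0//.
Qed.

Lemma density_box_gt0 (l r : R) (a b : 'I_n -> R) :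
  (forall y : n.-tuple R, (forall i, l <= tnth y i <= r) -> 0 < f y) ->
  (forall i, [/\ l <= a i, a i < b i & b i <= r]) ->
  (0 < P [set w | forall i, (a i <= Y i w <= b i)%R])%E.
Proof.
move=> fpos ab; have [mf f0 Pf] := Yf.
pose B : set (n.-tuple R) := [set t | forall i, a i <= tnth t i <= b i].
have mB : measurable B.
  rewrite (_ : B = \bigcap_(i in [set: 'I_n]) (fun t => tnth t i) @^-1` `[a i, b i]%classic).
    apply: fin_bigcap_measurable => // i _.
    have := @measurable_tnth _ R _ i measurableT _ (measurable_itv `[a i, b i]).
    by rewrite setTI.
  apply/seteqP; split => t /= tB; first by move=> i _; rewrite /= in_itv/=; exact: tB.
  by move=> i; have := tB i Logic.I; rewrite /= in_itv.
have := Pf _ mB; have -> : [set w | B [tuple Y i w | i < n]] =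
    [set w | forall i, a i <= Y i w <= b i].
  apply/seteqP; split => w; rewrite /B /= => h i; have := h i; by rewrite tnth_mktuple.
move=> ->.
(* Transfers the corners from ordinals to [nat]; the default 0 is never read at an index below
   [n]. *)
pose nt (g : 'I_n -> R) (k : nat) : R := if insub k is Some i then g i else 0.
have ntE g (i : 'I_n) : nt g i = g i by rewrite /nt valK.
apply: (@iter_integral_gt0 _ _ _ (nt a) (nt b)).
- by apply/measurable_EFinP; apply: measurable_funM => //; exact: measurable_indic.
- by move=> t; rewrite lee_fin mulr_ge0.
- by move=> i ilt; rewrite -[i]/(val (Ordinal ilt)) !ntE; have [] := ab (Ordinal ilt).
- move=> t tab; have tab' i : a i <= tnth t i <= b i.
    by have := tab i (ltn_ord i); rewrite !ntE -tnth_nth.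
  rewrite lte_fin mulr_gt0 ?indicE ?mem_set// ?ltr01//.
  apply: fpos => i; have [la _ br] := ab i; have /andP[h1 h2] := tab' i.
  by rewrite (le_trans la h1) (le_trans h2 br).
Qed.

End Density.

(** * Equality of laws *)

Section Laws.
Context d (T : measurableType d) (R : realType).

Lemma event_law (P : {measure set T -> \bar R}) (E : set T)
    d' (U : measurableType d') (V : T -> U) :
  measurable E -> measurable_fun setT V ->
  exists m : {measure set U -> \bar R}, forall A, m A = P (E `&` V @^-1` A).
Proof.
move=> mE mV.
exists (@measure_function_pushforward__canonical__measure_function_Measure _ _ _ _ _
  (mrestr P mE) V mV).
by move=> A; rewrite /= /pushforward /mrestr setIC.
Qed.

Variable P : probability T R.

(** [E] and [F] carry the conditions on the coordinates already treated, so that equality of joint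
    laws can be extended to measurable sets one coordinate at a time. The sequence [g] is the
    exhaustion by sets of finite mass in the uniqueness theorem for measures. *)
Lemma law_unique (E F : set T) d' (U : measurableType d') (V W : T -> U)
    (G : set (set U)) (g : (set U)^nat) :
  measurable = <<s G >> -> setI_closed G -> (forall i, G (g i)) ->
  \bigcup_k g k = setT ->
  measurable E -> measurable F -> measurable_fun setT V -> measurable_fun setT W ->
  (forall A, G A -> P (E `&` V @^-1` A) = P (F `&` W @^-1` A)) ->
  forall A, measurable A -> P (E `&` V @^-1` A) = P (F `&` W @^-1` A).
Proof.
move=> mG GI Gg gT mE mF mV mW EF A mA.
have [m1 m1E] := event_law P mE mV.
have [m2 m2E] := event_law P mF mW.
have mVE B : measurable B -> measurable (E `&` V @^-1` B).
  by move=> mB; apply: measurableI => //; rewrite -[X in measurable X]setTI; exact: mV.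
transitivity (m1 A); first exact/esym/m1E.
transitivity (m2 A); last exact: m2E.
apply: (measure_unique G g) => //.
  by move=> B GB; rewrite m1E m2E; exact: EF.
move=> k; rewrite m1E (le_lt_trans (probability_le1 P _)) ?ltry//.
by apply: mVE; rewrite mG; exact: sub_sigma_algebra.
Qed.

Lemma law_unique_ray (E F : set T) (V W : T -> R) :
  measurable E -> measurable F -> measurable_fun setT V -> measurable_fun setT W ->
  (forall x, P (E `&` V @^-1` `]-oo, x]) = P (F `&` W @^-1` `]-oo, x])) ->
  forall A, measurable A -> P (E `&` V @^-1` A) = P (F `&` W @^-1` A).
Proof.
move=> mE mF mV mW EF.
apply: (@law_unique E F _ R V W [set `]-oo, x]%classic | x in [set: R]]
  (fun n => `]-oo, n%:R]%classic)) => //.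
- apply/seteqP; split => A mA.
    have : (@RGenOInfty.G R).-sigma.-measurable A by rewrite -RGenOInfty.measurableE.
    apply: smallest_sub; first exact: smallest_sigma_algebra.
    move=> _ [x ->]; rewrite -setCitvl.
    have [_ + _] := smallest_sigma_algebra setT [set `]-oo, y]%classic | y in [set: R]].
    rewrite -setTD; apply; apply: sub_sigma_algebra; by exists x.
  apply: smallest_sub mA; first exact: sigma_algebra_measurable.
  by move=> _ [x _ <-]; exact: measurable_itv.
- move=> _ _ [x _ <-] [y _ <-]; exists (Num.min x y) => //.
  by apply/seteqP; split => z /=; rewrite !in_itv /= le_min => /andP.
- apply/seteqP; split => // x _; exists (Num.truncn `|x|).+1 => //=.
  by rewrite in_itv /= (le_trans (ler_norm x))// ltW// truncnS_gt.
- by move=> _ [x _ <-]; exact: EF.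
Qed.

Lemma law_unique_pair (E F : set T) d1 d2 (U1 : measurableType d1) (U2 : measurableType d2)
    (V1 W1 : T -> U1) (V2 W2 : T -> U2) :
  measurable E -> measurable F ->
  measurable_fun setT V1 -> measurable_fun setT W1 ->
  measurable_fun setT V2 -> measurable_fun setT W2 ->
  (forall A B, measurable A -> measurable B ->
     P (E `&` (V1 @^-1` A `&` V2 @^-1` B)) = P (F `&` (W1 @^-1` A `&` W2 @^-1` B))) ->
  forall S : set (U1 * U2), measurable S ->
    P (E `&` (fun w => (V1 w, V2 w)) @^-1` S) = P (F `&` (fun w => (W1 w, W2 w)) @^-1` S).
Proof.
move=> mE mF mV1 mW1 mV2 mW2 EF.
apply: (@law_unique _ _ _ _ _ _ [set A `*` B | A in measurable & B in measurable]
  (fun=> setT)) => //.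
- exact: measurable_prod_measurableType.
- move=> _ _ [A1 mA1 [A2 mA2 <-]] [B1 mB1 [B2 mB2 <-]].
  exists (A1 `&` B1); first exact: measurableI.
  exists (A2 `&` B2); first exact: measurableI.
  by rewrite setXI.
- by move=> _; exists setT => //; exists setT => //; rewrite setXTT.
- by rewrite bigcup_const//; exists 0%N.
- exact: measurable_fun_pair.
- exact: measurable_fun_pair.
- by move=> _ [A mA [B mB <-]]; exact: EF.
Qed.

(** Induction on the list [s] of coordinates whose set is arbitrary, the others being still rays.
    Each step frees one coordinate, with the conditions on all the others frozen into the events [E]
    and [F] of [law_unique_ray]. *)
Lemma law_unique_family (J : finType) (V W : J -> T -> R) :
  (forall j, measurable_fun setT (V j)) -> (forall j, measurable_fun setT (W j)) ->
  (forall z : J -> R, P [set w | forall j, V j w <= z j] = P [set w | forall j, W j w <= z j]) ->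
  forall B : J -> set R, (forall j, measurable (B j)) ->
    P [set w | forall j, B j (V j w)] = P [set w | forall j, B j (W j w)].
Proof.
move=> mV mW VW.
suff H (s : seq J) : forall B : J -> set R, (forall j, measurable (B j)) ->
    (forall j, j \notin s -> exists z, B j = `]-oo, z]%classic) ->
    P [set w | forall j, B j (V j w)] = P [set w | forall j, B j (W j w)].
  by move=> B mB; apply: (H (enum J)) => // j; rewrite mem_enum.
elim: s => [|k s IHs] B mB Bs.
  have /choice [z zB] : forall j, exists z, B j = `]-oo, z]%classic by move=> j; exact: Bs.
  have := VW z; congr (P _ = P _); apply/seteqP; split => w /= h j; have := h j;
    by rewrite zB /= in_itv.
have split1 (Z : J -> T -> R) (C : set R) :
    [set w | forall j, (if j == k then C else B j) (Z j w)] =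
    [set w | forall j, j != k -> B j (Z j w)] `&` Z k @^-1` C.
  apply/seteqP; split => w /=.
    move=> h; split; last by have := h k; rewrite eqxx.
    by move=> j jk; have := h j; rewrite (negbTE jk).
  by move=> [h1 h2] j; case: ifPn => [/eqP ->//|]; exact: h1.
have mS (Z : J -> T -> R) : (forall j, measurable_fun setT (Z j)) ->
    measurable [set w | forall j, j != k -> B j (Z j w)].
  move=> mZ; rewrite (_ : [set _ | _] = \bigcap_(j in [set j | j != k]) Z j @^-1` B j).
    apply: fin_bigcap_measurable; first exact: finite_finset.
    by move=> j _; rewrite -[X in measurable X]setTI; exact: mZ.
  by apply/seteqP; split => w.
have H := law_unique_ray (mS V mV) (mS W mW) (mV k) (mW k) _ (mB k).
have E (Z : J -> T -> R) : [set w | forall j, (if j == k then B k else B j) (Z j w)] =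
    [set w | forall j, B j (Z j w)].
  by apply/seteqP; split => w /= h j; have := h j; case: eqP => [->|].
rewrite -(E V) -(E W) !split1; apply: H => x; rewrite -(split1 V) -(split1 W).
apply: (IHs (fun j => if j == k then `]-oo, x]%classic else B j)) => [j|j js].
  by case: ifP => // _; exact: measurable_itv.
case: ifPn => [_|jk]; first by exists x.
by apply: Bs; rewrite inE negb_or jk.
Qed.

End Laws.

(** * Symmetry of the buyers *)

Section MaxOthers.
Context {R : realType} {m : nat}.
Implicit Types (v : 'I_m.+2 -> R) (n : 'I_m.+2).

Lemma max_others_leP v n z :
  (max_others v n <= z) <-> (forall j, v (lift n j) <= z).
Proof.
split => [/bigmax_leP[_ h] j|h]; first exact: h.
by apply/bigmax_leP; split => // j _; exact: h.
Qed.

Lemma max_others_ltP v n z :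
  (max_others v n < z) <-> (forall j, v (lift n j) < z).
Proof.
split => [/bigmax_ltP[_ h] j|h]; first exact: h.
by apply/bigmax_ltP; split => // j _; exact: h.
Qed.

Lemma le_max_others v n j : v (lift n j) <= max_others v n.
Proof. exact: (le_bigmax _ (fun j => v (lift n j))). Qed.

Lemma max_others_attained v n : exists j, max_others v n = v (lift n j).
Proof.
have [j _ jmax] := arg_maxP (fun j => v (lift n j)) (erefl true : xpredT (ord0 : 'I_m.+1)).
exists j; apply/eqP; rewrite eq_le le_max_others andbT.
by apply/max_others_leP => k; exact: jmax.
Qed.

Lemma lift_neq n k : k != n -> exists j, k = lift n j.
Proof. by rewrite eq_sym => /unlift_some[j -> _]; exists j. Qed.

Lemma max_others_homo v n (D : set R) (g : R -> R) :
  (forall k, D (v k)) -> {in D &, {homo g : x y / x < y}} ->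
  max_others (g \o v) n = g (max_others v n).
Proof.
move=> Dv gi; have [j Ej] := max_others_attained v n.
apply/eqP; rewrite eq_le; apply/andP; split; last first.
  by rewrite Ej; exact: (le_max_others (g \o v)).
apply/max_others_leP => k /=; rewrite Ej.
have : v (lift n k) <= v (lift n j) by rewrite -Ej le_max_others.
by rewrite le_eqVlt => /orP[/eqP ->//|/gi/ltW]; apply; apply: mem_set.
Qed.

Lemma measurable_max_others d (T : measurableType d) (Y : 'I_m.+2 -> T -> R) n :
  (forall k, measurable_fun setT (Y k)) ->
  measurable_fun setT (fun w => max_others (fun k => Y k w) n).
Proof.
move=> mY; rewrite /max_others unlock.
elim: (index_enum _) => [|j s IH] /=; first exact: mY.
exact: measurable_maxr.
Qed.

End MaxOthers.

Section Symmetry.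
Context d (T : measurableType d) (R : realType) (P : probability T R).
Context (m : nat) (X Y : 'I_m.+2 -> {RV P >-> R}).
Hypothesis symmetry : symmetric_law X Y.

Definition maxY (n : 'I_m.+2) (w : T) : R := max_others (fun k => Y k w) n.

Lemma measurable_maxY n : measurable_fun setT (maxY n).
Proof. exact: measurable_max_others. Qed.

(** [maxY n <= z] says that all opponents' signals are at most [z], so the joint distribution
    function of the triple is [joint_cdf] at a constant vector. The index type [option bool]
    presents the triple as a family. *)
Lemma symmetric_triple n (A B C : set R) :
  measurable A -> measurable B -> measurable C ->
  P (X n @^-1` A `&` (Y n @^-1` B `&` maxY n @^-1` C)) =
  P (X ord0 @^-1` A `&` (Y ord0 @^-1` B `&` maxY ord0 @^-1` C)).
Proof.
move=> mA mB mC.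
pose V k (o : option bool) : T -> R :=
  if o is Some b then if b then Y k : T -> R else maxY k else X k : T -> R.
pose B' (o : option bool) := if o is Some b then if b then B else C else A.
have mV k o : measurable_fun setT (V k o).
  by case: o => [[]|] //=; exact: measurable_maxY.
have mB' o : measurable (B' o) by case: o => [[]|].
have E k : X k @^-1` A `&` (Y k @^-1` B `&` maxY k @^-1` C) = [set w | forall o, B' o (V k o w)].
  apply/seteqP; split => w /= => [[h1 [h2 h3]] [[]|] //|h].
  by split; [exact: (h None)|split; [exact: (h (Some true))|exact: (h (Some false))]].
rewrite !E; apply: law_unique_family => // z.
have E' k : [set w | forall o, V k o w <= z o] =
    [set w | [/\ X k w <= z None, Y k w <= z (Some true) &
      forall j, Y (lift k j) w <= z (Some false)]].
  apply/seteqP; split => w /= => [h|[h1 h2 h3] [[]|] //].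
    split; [exact: (h None)|exact: (h (Some true))|].
    exact: (proj1 (max_others_leP (fun l => Y l w) k _) (h (Some false))).
  exact: (proj2 (max_others_leP (fun l => Y l w) k _) h3).
by rewrite !E'; exact: symmetry.1.
Qed.

Lemma symmetric_joint n (S : set (R * (R * R))) : measurable S ->
  P [set w | S (X n w, (Y n w, maxY n w))] =
  P [set w | S (X ord0 w, (Y ord0 w, maxY ord0 w))].
Proof.
have mYZ k : measurable_fun setT (fun w => (Y k w, maxY k w)).
  by apply: measurable_fun_pair => //; exact: measurable_maxY.
have pre k A : measurable A -> measurable (X k @^-1` A).
  by move=> mA; rewrite -[X in measurable X]setTI; exact: measurable_funPT.
have H := @law_unique_pair _ _ _ P setT setT _ _ _ _ (X n) (X ord0)
  (fun w => (Y n w, maxY n w)) (fun w => (Y ord0 w, maxY ord0 w)).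
move=> mS; move: H.
rewrite (_ : [set w | _] = setT `&` (fun w => (X n w, (Y n w, maxY n w))) @^-1` S);
  last by rewrite setTI.
rewrite (_ : [set w | S _] =
    setT `&` (fun w => (X ord0 w, (Y ord0 w, maxY ord0 w))) @^-1` S); last by rewrite setTI.
apply => // A B mA mB; rewrite !setTI.
apply: law_unique_pair => //; try exact: pre; try exact: measurable_maxY.
by move=> C D mC mD; exact: symmetric_triple.
Qed.

Lemma symmetric_integral n (D : set (R * R)) (F : R * (R * R) -> R) :
  measurable D -> measurable_fun setT F ->
  P.-integrable [set w | D (Y ord0 w, maxY ord0 w)]
    (fun w => (F (X ord0 w, (Y ord0 w, maxY ord0 w)))%:E) ->
  P.-integrable [set w | D (Y n w, maxY n w)]
    (fun w => (F (X n w, (Y n w, maxY n w)))%:E) /\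
  \int[P]_(w in [set w | D (Y n w, maxY n w)]) F (X n w, (Y n w, maxY n w)) =
  \int[P]_(w in [set w | D (Y ord0 w, maxY ord0 w)]) F (X ord0 w, (Y ord0 w, maxY ord0 w)).
Proof.
move=> mD mF iF.
pose V k w := (X k w, (Y k w, maxY k w)).
have mV k : measurable_fun setT (V k).
  by do 2 apply: measurable_fun_pair => //; exact: measurable_maxY.
pose D' := setT `*` D : set (R * (R * R)).
have mD' : measurable D' by exact: measurableX.
have DE k : [set w | D (Y k w, maxY k w)] = V k @^-1` D'.
  by apply/seteqP; split => w //= -[].
have mFE : measurable_fun setT (EFin \o F) by exact/measurable_EFinP.
have eqm k A : measurable A -> A `<=` D' ->
    pushforward P (V k) A = pushforward P (V ord0) A.
  by move=> mA _; exact: symmetric_joint.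
rewrite !DE in iF *.
have iFn : P.-integrable (V n @^-1` D') ((EFin \o F) \o V n).
  have [mF0 fF0] := integrableP _ _ _ iF.
  apply/integrableP; split.
    apply: measurable_funTS; exact: measurableT_comp.
  have absE k : (\int[P]_(x in V k @^-1` D') `|((EFin \o F) \o V k) x| =
      \int[pushforward P (V k)]_(y in D') `|(EFin \o F) y|)%E.
    rewrite (ge0_integral_pushforward (mV k))//.
    by apply: measurable_funTS; exact: measurableT_comp.
  have -> : (\int[P]_(x in V n @^-1` D') `|((EFin \o F) \o V n) x| =
      \int[P]_(x in V ord0 @^-1` D') `|((EFin \o F) \o V ord0) x|)%E.
    by rewrite !absE; apply: eq_measure_integral => A; exact: eqm.
  exact: fF0.
split; first exact: iFn.
congr fine.
rewrite -[LHS](@integral_pushforward _ _ _ _ _ _ (mV n) P D' (EFin \o F))//.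
rewrite -[RHS](@integral_pushforward _ _ _ _ _ _ (mV ord0) P D' (EFin \o F))//.
exact: eq_measure_integral (eqm n).
Qed.

Definition perm_index (s : 'S_m.+1) (n : 'I_m.+2) : 'I_m.+2 :=
  if unlift ord0 n is Some j then lift ord0 (s j) else ord0.

(** Reindexing moves the permutation from the sets to the signals, where it becomes [s^-1] and the
    joint distribution function is invariant. *)
Lemma symmetric_box (s : 'S_m.+1) (A : set R) (B : 'I_m.+2 -> set R) :
  measurable A -> (forall n, measurable (B n)) ->
  P [set w | A (X ord0 w) /\ forall n, B (perm_index s n) (Y n w)] =
  P [set w | A (X ord0 w) /\ forall n, B n (Y n w)].
Proof.
move=> mA mB.
pose V (o : option 'I_m.+2) : T -> R :=
  if o is Some k then Y (perm_index s^-1%g k) : T -> R else X ord0 : T -> R.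
pose W (o : option 'I_m.+2) : T -> R :=
  if o is Some k then Y k : T -> R else X ord0 : T -> R.
pose B' (o : option 'I_m.+2) := if o is Some k then B k else A.
have pK : cancel (perm_index s) (perm_index s^-1%g).
  move=> n; rewrite /perm_index; case: (unliftP ord0 n) => [j ->|->]; rewrite ?unlift_none//.
  by rewrite liftK permK.
have pK' : cancel (perm_index s^-1%g) (perm_index s).
  move=> n; rewrite /perm_index; case: (unliftP ord0 n) => [j ->|->]; rewrite ?unlift_none//.
  by rewrite liftK permKV.
have -> : [set w | A (X ord0 w) /\ forall n, B (perm_index s n) (Y n w)] =
   [set w | forall o, B' o (V o w)].
  apply/seteqP; split => w /= => [[h1 h2] [k|] //=|h].
    by have := h2 (perm_index s^-1%g k); rewrite pK'.
  split => [|n]; first exact: (h None).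
  by have := h (Some (perm_index s n)); rewrite /= pK.
have -> : [set w | A (X ord0 w) /\ forall n, B n (Y n w)] = [set w | forall o, B' o (W o w)].
  apply/seteqP; split => w /= => [[h1 h2] [k|] //=|h].
  by split => [|n]; [exact: (h None)|exact: (h (Some n))].
apply: law_unique_family; [by case|by case| |by case].
move=> z.
have -> : [set w | forall o, V o w <= z o] =
    [set w | [/\ X ord0 w <= z None, Y ord0 w <= z (Some ord0) &
      forall j, Y (lift ord0 j) w <= ((fun j => z (Some (lift ord0 j))) \o s) j]].
  apply/seteqP; split => w /= => [h|[h1 h2 h3] [k|] //=].
    split; [exact: (h None)|by have := h (Some ord0); rewrite /= /perm_index unlift_none|].
    move=> j; have := h (Some (perm_index s (lift ord0 j))).
    by rewrite /= pK /perm_index liftK.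
  have := h3; rewrite /perm_index; case: unliftP => [j ->|-> //] /(_ (s^-1%g j)) /=.
  by rewrite permKV.
rewrite -[P _]/(joint_cdf X Y ord0 _ _ _) symmetry.2 /joint_cdf; congr (P _).
apply/seteqP; split => w /= => [[h1 h2 h3] [k|] //=|h].
  by have [j ->|->] := unliftP ord0 k.
by split; [exact: (h None)|exact: (h (Some ord0))|move=> j; exact: (h (Some (lift ord0 j)))].
Qed.

End Symmetry.

(** * Disintegration *)

Section Disintegration.
Context d d' (T : measurableType d) (U : measurableType d') (R : realType).
Context (P : probability T R).

(** The mixture is a bind in the Giry monad, which supplies the measurability and the integral
    formula. Off [G], where nothing is known of [k], the kernel is replaced by the zero measure;
    hence subprobabilities. *)
Lemma kernel_mixture (G : set T) (k : T -> probability U R) :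
  measurable G ->
  (forall A, measurable A -> measurable_fun G (fun w => k w A)) ->
  exists nu : {measure set U -> \bar R},
    (forall A, measurable A -> nu A = \int[P]_(w in G) k w A)%E /\
    (forall h : U -> \bar R, measurable_fun setT h -> (forall x, 0 <= h x)%E ->
      measurable_fun G (fun w => \int[k w]_x h x)%E /\
      (\int[nu]_x h x = \int[P]_(w in G) \int[k w]_x h x)%E).
Proof.
move=> mG mk.
pose k' (w : T) : giry U R :=
  if w \in G then (k w : subprobability U R) else (mzero : subprobability U R).
have mk' : measurable_fun setT k'.
  apply: measurable_giry_codensity => // B mB.
  rewrite (_ : (fun w => _) = (fun w => k w B) \_ G).
    by apply/measurable_restrict => //; rewrite setTI; exact: mk.
  by apply/funext => w; rewrite patchE /k'; case: ifPn.
have intE (h : U -> \bar R) : (fun w => giry_int (k' w) h) = (fun w => \int[k w]_x h x)%E \_ G.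
  apply/funext => w; rewrite patchE /k' /giry_int; case: ifPn => // _.
  by rewrite integral_measure_zero.
have H (h : U -> \bar R) : measurable_fun setT h -> (forall x, 0 <= h x)%E ->
    (\int[giry_bind (P : subprobability T R) mk']_x h x = \int[P]_(w in G) \int[k w]_x h x)%E.
  move=> mh h0; rewrite -[LHS]/(giry_int _ h) giry_int_bind//.
  by rewrite {1}/giry_int intE -integral_mkcond.
exists (giry_bind (P : subprobability T R) mk'); split.
  move=> A mA.
  have m1 : measurable_fun setT (EFin \o \1_A : U -> \bar R).
    by apply/measurable_EFinP; exact: measurable_indic.
  have := H _ m1; rewrite integral_indic// setIT => ->; last by move=> x; rewrite lee_fin.
  by apply: eq_integral => w _; rewrite integral_indic// setIT.
move=> h mh h0; split; last exact: H.
have : measurable_fun setT (fun w => giry_int (k' w) h).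
  exact: (measurableT_comp (measurable_giry_int mh h0) mk').
by rewrite intE => /(measurable_restrict _ mG measurableT); rewrite setTI.
Qed.

Context (X : T -> U) (G : set T) (k : T -> probability U R).
Hypothesis mX : measurable_fun setT X.
Hypothesis mG : measurable G.
Hypothesis kX : forall A, measurable A ->
  measurable_fun G (fun w => k w A) /\
  P (G `&` X @^-1` A) = (\int[P]_(w in G) k w A)%E.

Lemma ge0_disintegration (h : U -> \bar R) :
  measurable_fun setT h -> (forall x, 0 <= h x)%E ->
  measurable_fun G (fun w => \int[k w]_x h x)%E /\
  (\int[P]_(w in G) h (X w) = \int[P]_(w in G) \int[k w]_x h x)%E.
Proof.
move=> mh h0.
have [nu1 [nu1A nu1h]] := kernel_mixture mG (fun A mA => (kX mA).1).
(* The law of [X] on [G] is itself a mixture, of the Dirac measures at [X w]. The two mixtures agree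
   on measurable sets, so they have the same integrals. *)
have [|nu2 [nu2A nu2h]] := @kernel_mixture G (fun w => \d_(X w)) mG.
  move=> A mA; apply/measurable_EFinP/measurable_funTS.
  by apply: measurableT_comp mX; exact: measurable_indic.
have [mk <-] := nu1h _ mh h0; split => //.
have <- : (\int[nu2]_x h x = \int[nu1]_x h x)%E.
  apply: eq_measure_integral => A mA _; rewrite nu1A// nu2A// -(kX mA).2.
  rewrite integral_indic//; last by rewrite -[X in measurable X]setTI; exact: mX.
  by rewrite setIC.
have [_ ->] := nu2h _ mh h0.
by apply: eq_integral => w _; rewrite integral_dirac// diracT mul1e.
Qed.

Lemma disintegration (h : U -> R) : measurable_fun setT h ->
  P.-integrable G (fun w => (h (X w))%:E) ->
  (forall w, G w -> (k w).-integrable setT (EFin \o h)) ->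
  P.-integrable G (fun w => (\int[k w]_x h x)%:E) /\
  \int[P]_(w in G) h (X w) = \int[P]_(w in G) (\int[k w]_x h x).
Proof.
move=> mh ih ik.
have mhE : measurable_fun setT (EFin \o h) by exact/measurable_EFinP.
have [mp Ep] := ge0_disintegration (measurable_funepos mhE) (funepos_ge0 _).
have [mn En] := ge0_disintegration (measurable_funeneg mhE) (funeneg_ge0 _).
have kE w : G w -> (\int[k w]_x h x)%:E =
    (\int[k w]_x (EFin \o h)^\+ x - \int[k w]_x (EFin \o h)^\- x)%E.
  move=> Gw; rewrite -integralE /Rintegral fineK//.
  by apply: integrable_fin_num => //; exact: ik.
have ip : P.-integrable G (fun w => \int[k w]_x (EFin \o h)^\+ x)%E.
  apply/integrableP; split => //.
  under eq_integral do rewrite gee0_abs ?integral_ge0//.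
  rewrite -Ep; apply: le_lt_trans (integral_funepos_lt_pinfty mG ih).
  by rewrite le_eqVlt; apply/orP; left; apply/eqP; apply: eq_integral => w _; rewrite !funeposE.
have iN : P.-integrable G (fun w => \int[k w]_x (EFin \o h)^\- x)%E.
  apply/integrableP; split => //.
  under eq_integral do rewrite gee0_abs ?integral_ge0//.
  rewrite -En; apply: le_lt_trans (integral_funeneg_lt_pinfty mG ih).
  by rewrite le_eqVlt; apply/orP; left; apply/eqP; apply: eq_integral => w _; rewrite !funenegE.
have iB := integrableB mG ip iN.
have E : {in G, (fun w => (\int[k w]_x (EFin \o h)^\+ x - \int[k w]_x (EFin \o h)^\- x)%E) =1
    (fun w => (\int[k w]_x h x)%:E)}.
  by move=> w /set_mem Gw; rewrite kE.
split; first exact: eq_integrable iB.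
rewrite /Rintegral; congr fine; rewrite -(eq_integral _ _ E) integralB// -Ep -En.
rewrite integralE; congr (_ - _)%E; apply: eq_integral => w _.
  by rewrite !funeposE.
by rewrite !funenegE.
Qed.

End Disintegration.

(** * Conditional laws on boxes of signals *)

Section AlmostSure.
Context d (T : measurableType d) (R : realType) (P : probability T R).

Lemma conull_setC (I : set T) : measurable I -> P I = 1%E -> P (~` I) = 0%E.
Proof. by move=> mI PI; rewrite probability_setC// PI subee. Qed.

Lemma integrable_comp_RV (X : T -> R) (xl xr : R) (h : R -> R) (G : set T) :
  measurable_fun setT X -> P (X @^-1` `[xl, xr]) = 1%E -> continuous h ->
  measurable G -> P.-integrable G (fun w => (h (X w))%:E).
Proof.
move=> mX PX ch mG.
have mpre A : measurable A -> measurable (X @^-1` A).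
  by move=> mA; rewrite -[X in measurable X]setTI; exact: mX.
have mI : measurable (X @^-1` `[xl, xr]) by apply: mpre; exact: measurable_itv.
have mhX : measurable_fun setT (h \o X).
  by apply: measurableT_comp mX; exact: continuous_measurable_fun.
apply: (@integrableS _ _ _ _ setT) => //.
apply/(negligible_integrable (measurableC mI) measurableT).
- exact/measurable_EFinP.
- exact: conull_setC.
rewrite setDE setCK setTI; apply: measurable_bounded_integrable => //.
- by rewrite (le_lt_trans (probability_le1 _ _))// ltry.
- exact: measurable_funTS.
- have /compact_bounded [M [Mr HM]] : compact (h @` `[xl, xr]%classic).
    by apply: continuous_compact; [exact: continuous_subspaceT|exact: segment_compact].
  by exists M; split => // x /HM hx y Iy; apply: hx; exists (X y).
Qed.

Lemma Rintegral_null_congr (E F N : set T) (f : T -> R) :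
  measurable E -> measurable F -> measurable N -> P N = 0%E ->
  E `\` N = F `\` N -> P.-integrable setT (EFin \o f) ->
  \int[P]_(w in E) f w = \int[P]_(w in F) f w.
Proof.
move=> mE mF mN N0 EF fi.
rewrite (Rintegral_setDnull mE mN _ N0); last exact: integrableS fi.
by rewrite EF -(Rintegral_setDnull mF mN _ N0)//; exact: integrableS fi.
Qed.

Lemma probability_null_congr (E F N : set T) :
  measurable E -> measurable F -> measurable N -> P N = 0%E ->
  E `\` N = F `\` N -> P E = P F.
Proof.
move=> mE mF mN N0 EF.
have H A : measurable A -> P A = P (A `\` N).
  move=> mA; have AN0 : P (A `&` N) = 0%E.
    by apply: (subset_measure0 _ _ _ N0) => //; exact: measurableI.
  have := measureDI P mA mN; rewrite [X in (_ + X)%E]AN0 adde0; exact.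
by rewrite (H E)// (H F)// EF.
Qed.

Lemma conull_setI (E I : set T) : measurable E -> measurable I -> P I = 1%E ->
  P (E `&` I) = P E.
Proof.
move=> mE mI PI; apply: (@probability_null_congr _ _ (~` I)) => //.
- exact: measurableI.
- exact: measurableC.
- exact: conull_setC.
- by rewrite !setDE setCK -setIA setIid.
Qed.

End AlmostSure.

Lemma within_continuous_eps (R : realType) (U : pseudoMetricType R) (A : set U)
    (F : U -> R) (x : U) (dl : R) :
  {within A, continuous F} -> A x -> 0 < dl ->
  exists2 eta, 0 < eta & forall y, A y -> ball x eta y -> `|F x - F y| <= dl.
Proof.
move=> /subspace_continuousP cF Ax dl0.
have /cvgrPdist_le /(_ _ dl0) := cF x Ax.
rewrite near_withinE => /nbhs_ballP[eta /= eta0 H].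
by exists eta => // y Ay bxy; exact: H.
Qed.

Lemma row_ball (R : realType) (n : nat) (a b : 'rV[R]_n.+1) (eta : R) :
  0 < eta -> (forall k, `|a 0 k - b 0 k| < eta) -> ball a eta b.
Proof. by move=> eta0 H; split => // i k; rewrite ord1; exact: H. Qed.

Section Boxes.
Context d (T : measurableType d) (R : realType) (P : probability T R) (m : nat).
Context (X Y : 'I_m.+2 -> {RV P >-> R}) (xl xr yl yr : R) (f : m.+2.-tuple R -> R).
Context (K : 'rV[R]_m.+2 -> 'rV[R]_m.+2 -> probability R R).
Context (KZ : R -> R -> probability R R).
Hypothesis symmetry : symmetric_law X Y.
Hypothesis X_values : is_support P (X ord0) `[xl, xr].
Hypothesis Y_values : is_support P (Y ord0) `[yl, yr].
Hypothesis Y_density : is_joint_density P Y f.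
Hypothesis Y_density_pos : forall y : m.+2.-tuple R,
     (forall i, yl <= tnth y i <= yr) -> 0 < f y.
Hypothesis K_law : box_cond_law yl yr (X ord0) Y K.
Hypothesis K_pos_dep : positive_dependence yl yr K.
Hypothesis K_cont : box_continuity yl yr K.
Hypothesis KZ_law : Z1_cond_law yl yr (X ord0) Y KZ.

Lemma X1_carried : P (X ord0 @^-1` `[xl, xr]) = 1%E.
Proof. by case: X_values. Qed.

Lemma measurable_preX n A : measurable A -> measurable (X n @^-1` A).
Proof. by move=> mA; rewrite -[X in measurable X]setTI; exact: measurable_funPT. Qed.

Lemma measurable_preY n A : measurable A -> measurable (Y n @^-1` A).
Proof. by move=> mA; rewrite -[X in measurable X]setTI; exact: measurable_funPT. Qed.

Lemma Y_carried n : P (Y n @^-1` `[yl, yr]) = 1%E.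
Proof.
have [_ + _] := Y_values => <-.
have := symmetric_triple symmetry n measurableT (measurable_itv `[yl, yr]) measurableT.
by rewrite !preimage_setT !setTI !setIT.
Qed.

Lemma yl_lt_yr : yl < yr.
Proof.
have P0 : P (Y ord0 @^-1` `[yl, yr]) != 0%E by rewrite Y_carried oner_neq0.
rewrite ltNge; apply/negP => le; move/eqP: P0; apply.
apply: (@subset_measure0 _ _ _ P _ [set w | Y ord0 w = yl]).
- by apply: measurable_preY; exact: measurable_itv.
- by apply: (measurable_preY ord0 (measurable_set1 yl)).
- move=> w; rewrite /= in_itv /= => /andP[h1 h2].
  by apply/eqP; rewrite eq_le h1 (le_trans h2 le).
- exact: density_null_pt Y_density _ _.
Qed.

Lemma X1_integrable h G : continuous h -> measurable G ->
  P.-integrable G (fun w => (h (X ord0 w))%:E).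
Proof. by move=> ch mG; exact: integrable_comp_RV X1_carried ch mG. Qed.

(** * Boxes of positive probability *)

Definition box_event (a b : 'rV[R]_m.+2) : set T :=
  [set w | forall n, a 0 n <= Y n w <= b 0 n].

(** On these boxes [K] is determined by the joint law; the other boxes are reached as limits of
    them. *)
Definition fat_box (a b : 'rV[R]_m.+2) :=
  forall n, [/\ yl <= a 0 n, a 0 n < b 0 n & b 0 n <= yr].

Lemma fat_box_boxes a b : fat_box a b -> boxes yl yr (a, b).
Proof.
move=> fb; split => n /=; have [h1 h2 h3] := fb n.
- by rewrite h1 (le_trans (ltW h2)).
- by rewrite h3 andbT (le_trans h1)// ltW.
- exact: ltW.
Qed.

Lemma measurable_box_event a b : measurable (box_event a b).
Proof.
rewrite (_ : box_event a b = \bigcap_(n in [set: 'I_m.+2]) Y n @^-1` `[a 0 n, b 0 n]%classic).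
  apply: fin_bigcap_measurable; first exact: finite_finset.
  by move=> n _; apply: measurable_preY; exact: measurable_itv.
apply/seteqP; split => w /= h n; first by move=> _; rewrite /= in_itv; exact: h.
by have := h n Logic.I; rewrite /= in_itv.
Qed.

Lemma box_event_gt0 a b : fat_box a b -> (0 < P (box_event a b))%E.
Proof.
by move=> fb; exact: (density_box_gt0 (a := a 0) (b := b 0) Y_density Y_density_pos fb).
Qed.

Lemma box_event_fin_gt0 a b : fat_box a b -> 0 < fine (P (box_event a b)).
Proof.
move=> /box_event_gt0 h; apply: fine_gt0; rewrite h /=.
by rewrite (le_lt_trans (probability_le1 P (measurable_box_event a b)))// ltry.
Qed.

Lemma box_law a b A : boxes yl yr (a, b) -> measurable A ->
  (P (box_event a b `&` X ord0 @^-1` A) = K a b A * P (box_event a b))%E.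
Proof.
move=> ab mA.
have mB0 (n : 'I_m.+2) : measurable (set0 : set R) /\ set0 `<=` (`[yl, yr]%classic : set R).
  by split; [exact: measurable0|exact: sub0set].
have := @K_law finset.set0 a b (fun=> set0) ab mB0 A mA.
have spl v c : splice finset.set0 v c = c by apply/rowP => n; rewrite !mxE finset.in_set0.
have -> : [set w | forall n, if n \in (finset.set0 : {set 'I_m.+2}) then set0 (Y n w) else
    a 0 n <= Y n w <= b 0 n] = box_event a b.
  by apply/seteqP; split => w /= h n; have := h n; rewrite finset.in_set0.
move=> [_ ->]; under eq_integral do rewrite !spl.
rewrite -[X in (\int[P]_(w in _) X)%E]fineK ?fin_num_measure//.
by rewrite integral_cst ?fineK ?fin_num_measure//; exact: measurable_box_event.
Qed.

Lemma fat_box_exp a b h : fat_box a b -> continuous h ->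
  (K a b).-integrable setT (EFin \o h) ->
  \int[P]_(w in box_event a b) h (X ord0 w) = box_exp K h a b * fine (P (box_event a b)).
Proof.
move=> fb ch ih.
have mG := measurable_box_event a b.
have kX A : measurable A -> measurable_fun (box_event a b) (fun=> K a b A) /\
    (P (box_event a b `&` X ord0 @^-1` A) = \int[P]_(w in box_event a b) K a b A)%E.
  move=> mA; split => //; rewrite box_law//; last exact: fat_box_boxes.
  rewrite -[X in (\int[P]_(w in _) X)%E]fineK ?fin_num_measure//.
  by rewrite integral_cst ?fineK ?fin_num_measure.
have [_ ->] := disintegration (measurable_funPT (X ord0)) mG kX
  (continuous_measurable_fun ch) (X1_integrable ch mG) (fun w _ => ih).
by rewrite Rintegral_cst.
Qed.

Lemma fat_box_carried a b : fat_box a b -> K a b `[xl, xr]%classic = 1%E.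
Proof.
move=> fb; have mI := measurable_itv `[xl, xr].
have := box_law (fat_box_boxes fb) mI.
rewrite conull_setI; [|exact: measurable_box_event|exact: measurable_preX|exact: X1_carried].
have PG0 := box_event_gt0 fb.
rewrite -(@fineK _ (P (box_event a b))) ?fin_num_measure//; last exact: measurable_box_event.
rewrite -(@fineK _ (K a b _)) ?fin_num_measure// -EFinM => -[] E.
congr (_%:E); apply: (mulIf (lt0r_neq0 (box_event_fin_gt0 fb))).
by rewrite -E mul1r.
Qed.

(* [K] and [KZ] are continuous for all bounded test functions; this one detects
   mass outside [[xl, xr]]. *)
Definition outside (x : R) : R := Num.min 1 (Num.max 0 (Num.max (xl - x) (x - xr))).

Lemma outside_continuous : continuous outside.
Proof.
move=> x; apply: (@continuous_min _ _ (fun=> 1) (fun x => Num.max 0 (Num.max (xl - x) (x - xr)))).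
  exact: cst_continuous.
apply: (@continuous_max _ _ (fun=> 0) (fun x => Num.max (xl - x) (x - xr))).
  exact: cst_continuous.
apply: (@continuous_max _ _ (fun x => xl - x) (fun x => x - xr)).
  by apply: cvgB; [exact: cvg_cst|exact: cvg_id].
by apply: cvgB; [exact: cvg_id|exact: cvg_cst].
Qed.

Lemma outside_ge0 x : 0 <= outside x.
Proof. by rewrite /outside le_min ler01 le_max lexx. Qed.

Lemma outside_integrable (nu : probability R R) : nu.-integrable setT (EFin \o outside).
Proof.
apply: measurable_bounded_integrable => //.
- by rewrite (le_lt_trans (probability_le1 nu measurableT))// ltry.
- exact: (continuous_measurable_fun outside_continuous).
- exists 1; split => // M M1 x _ /=.
  by rewrite ger0_norm ?outside_ge0// (le_trans _ (ltW M1))// /outside ge_min lexx.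
Qed.

Lemma outside0 x : xl <= x <= xr -> outside x = 0.
Proof.
move=> /andP[h1 h2]; rewrite /outside (max_idPl _) ?(min_idPr _)//.
by rewrite ge_max !subr_le0 h1.
Qed.

Lemma outside_carried (nu : probability R R) :
  \int[nu]_x outside x = 0 -> nu `[xl, xr]%classic = 1%E.
Proof.
move=> E; have mI := measurable_itv `[xl, xr].
have E' : (\int[nu]_x (outside x)%:E = 0)%E.
  rewrite -[LHS]fineK; last by apply: integrable_fin_num => //; exact: outside_integrable.
  by rewrite -/(Rintegral _ _ _) E.
have : ~ (0 < nu (~` `[xl, xr]%classic))%E.
  move=> n0.
  suff : (0 < \int[nu]_x (outside x)%:E)%E by rewrite E' ltxx.
  apply: (ge0_integral_gt0 (measurableC mI) n0).
  - by apply/measurable_EFinP; exact: (continuous_measurable_fun outside_continuous).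
  - by move=> x; rewrite lee_fin outside_ge0.
  - move=> x /= /negP; rewrite in_itv /= negb_and -!ltNge => h.
    by rewrite lte_fin /outside lt_min ltr01 /= !lt_max !subr_gt0 h orbT.
have := probability_setC nu (measurableC mI); rewrite setCK => ->.
move=> /negP; rewrite -leNgt => h.
have -> : nu (~` `[xl, xr]%classic) = 0%E.
  by apply/eqP; rewrite eq_le h measure_ge0.
by rewrite sube0.
Qed.

(** * Degenerate boxes as limits *)

Lemma box_exp_eps h a b dl : continuous h -> boxes yl yr (a, b) ->
  (forall a b, boxes yl yr (a, b) -> box_exp_exists K h a b) -> 0 < dl ->
  exists2 eta, 0 < eta & forall a' b', boxes yl yr (a', b') ->
    (forall k, `|a 0 k - a' 0 k| < eta) -> (forall k, `|b 0 k - b' 0 k| < eta) ->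
    `|box_exp K h a b - box_exp K h a' b'| <= dl.
Proof.
move=> ch ab ex dl0.
have [eta eta0 H] := within_continuous_eps (K_cont ch) (conj ab (ex _ _ ab)) dl0.
exists eta => // a' b' ab' aa' bb'; apply: (H (a', b')); first by split => //; exact: ex.
by split; exact: row_ball.
Qed.

(** Each endpoint moves outwards by the fraction [t] of its distance to the end of [[yl, yr]]. As
    [yl < yr], at least one endpoint really moves when the two coincide, so every side gets positive
    length. *)
Lemma fat_box_dense a b eta : boxes yl yr (a, b) -> 0 < eta ->
  exists a' b', [/\ fat_box a' b', forall k, `|a 0 k - a' 0 k| < eta &
    forall k, `|b 0 k - b' 0 k| < eta].
Proof.
move=> [ca cb ab] eta0; have ylr := yl_lt_yr.
have [t t0 [t1 teta]] : exists2 t : R, 0 < t & t <= 1 /\ t * (yr - yl) < eta.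
  pose t := Num.min 1 (eta / (yr - yl) / 2).
  have p1 : 0 < eta / (yr - yl) / 2 by rewrite !divr_gt0// subr_gt0.
  exists t; first by rewrite lt_min ltr01 p1.
  split; first by rewrite ge_min lexx.
  rewrite -ltr_pdivlMr ?subr_gt0//; apply: (@le_lt_trans _ _ (eta / (yr - yl) / 2)).
    by rewrite ge_min lexx orbT.
  by rewrite ltr_pdivrMr// ltr_pMr ?ltr1n// divr_gt0// subr_gt0.
have tle x : 0 <= x <= yr - yl -> 0 <= t * x <= t * (yr - yl) /\ t * x <= x.
  move=> /andP[x0 x1]; split.
    by rewrite mulr_ge0 ?(ltW t0)//= ler_wpM2l// ltW.
  by rewrite ler_piMl.
exists (\row_k (a 0 k - t * (a 0 k - yl))), (\row_k (b 0 k + t * (yr - b 0 k))).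
split => k; rewrite ?mxE; move: (ca k) (cb k) (ab k) => /= /andP[a1 a2] /andP[b1 b2] abk;
  have [/andP[u1 u2] u3] := tle (a 0 k - yl) ltac:(lra);
  have [/andP[v1 v2] v3] := tle (yr - b 0 k) ltac:(lra).
- split; [lra| |lra].
  have : 0 < t * ((a 0 k - yl) + (yr - b 0 k)) \/ a 0 k < b 0 k.
    have [|h] := ltP (a 0 k) (b 0 k); first by right.
    by left; rewrite mulr_gt0//; lra.
  by rewrite mulrDr => -[|]; lra.
- by rewrite opprB addrCA subrr addr0 ger0_norm//; lra.
- by rewrite opprD addrA subrr sub0r normrN ger0_norm//; lra.
Qed.

(** The mean of [outside] vanishes on fat boxes, and continuity passes this on. Every continuous
    function is then integrable for every [K a b], which discharges the existence clauses in
    positive dependence and continuity. *)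
Lemma box_carried a b : boxes yl yr (a, b) -> K a b `[xl, xr]%classic = 1%E.
Proof.
move=> ab; apply: outside_carried; apply/eqP; rewrite -normr_le0.
apply/ler_addgt0Pl => dl dl0; rewrite addr0.
have [eta eta0 H] := box_exp_eps outside_continuous ab
  (fun a b _ => outside_integrable (K a b)) dl0.
have [a' [b' [fb aa' bb']]] := fat_box_dense ab eta0.
have := H a' b' (fat_box_boxes fb) aa' bb'.
rewrite (_ : box_exp K outside a' b' = 0) ?subr0//.
rewrite /box_exp (carried_Rintegral (fat_box_carried fb) outside_continuous).
rewrite (@eq_Rintegral _ _ _ _ _ (cst 0)); first by rewrite Rintegral_cst// mul0r.
by move=> x /set_mem /=; rewrite in_itv /= => /outside0.
Qed.

Lemma box_exists h a b : continuous h -> boxes yl yr (a, b) -> box_exp_exists K h a b.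
Proof.
move=> ch ab; rewrite /box_exp_exists.
exact: (carried_integrable (box_carried ab) ch).
Qed.

(** * The conditional law given the own signal and the highest other signal *)

Let YZ (w : T) : R * R := (Y ord0 w, Z1 Y w).

Lemma measurable_YZ : measurable_fun setT YZ.
Proof. by apply: measurable_fun_pair => //; exact: (measurable_maxY Y ord0). Qed.

Lemma measurable_preYZ S : measurable S -> measurable (YZ @^-1` S).
Proof. by move=> mS; rewrite -[X in measurable X]setTI; exact: measurable_YZ. Qed.

Definition square : set (R * R) := `[yl, yr]%classic `*` `[yl, yr]%classic.

Lemma measurable_square : measurable square.
Proof. by apply: measurableX; exact: measurable_itv. Qed.

(* [KZ_law] speaks of rectangles only; Dynkin's lemma extends it. *)
Lemma KZ_law_ext S A : measurable S -> S `<=` square -> measurable A ->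
  measurable_fun (YZ @^-1` S) (fun w => KZ (Y ord0 w) (Z1 Y w) A) /\
  P (YZ @^-1` S `&` X ord0 @^-1` A) =
  (\int[P]_(w in YZ @^-1` S) KZ (Y ord0 w) (Z1 Y w) A)%E.
Proof.
move=> mS Ssq mA.
set g := fun w => KZ (Y ord0 w) (Z1 Y w) A.
pose G := YZ @^-1` square; pose E := G `&` X ord0 @^-1` A.
have mG : measurable G by apply: measurable_preYZ; exact: measurable_square.
have mE : measurable E by apply: measurableI => //; exact: measurable_preX.
have rect B B' : measurable B -> measurable B' -> B `<=` `[yl, yr] -> B' `<=` `[yl, yr] ->
    measurable_fun (YZ @^-1` (B `*` B')) g /\
    P (YZ @^-1` (B `*` B') `&` X ord0 @^-1` A) = (\int[P]_(w in YZ @^-1` (B `*` B')) g w)%E.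
  by move=> mB mB' Bl Bl'; exact: (KZ_law.1 B B' mB mB' Bl Bl' A mA).
have mI := measurable_itv `[yl, yr].
have [mg PG] := rect _ _ mI mI (@subset_refl _ _) (@subset_refl _ _).
split.
  by apply: measurable_funS mg => // w; exact: Ssq.
have g0 w : (0 <= g w)%E by [].
have mGS C : measurable C -> measurable (G `&` YZ @^-1` C).
  by move=> mC; apply: measurableI => //; exact: measurable_preYZ.
have mgS C : measurable C -> measurable_fun (G `&` YZ @^-1` C) g.
  by move=> mC; apply: measurable_funS mg.
suff : P (E `&` YZ @^-1` S) = (\int[P]_(w in G `&` YZ @^-1` S) g w)%E.
  rewrite (_ : G `&` YZ @^-1` S = YZ @^-1` S); last first.
    by apply/seteqP; split => w /= => [[]//|Sw]; split => //; exact: Ssq.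
  move=> <-; congr (P _); rewrite /E setIAC; congr (_ `&` _).
  by apply/seteqP; split => w /= => [Sw|[]//]; split => //; exact: Ssq.
move: S {Ssq} mS; rewrite measurable_prod_measurableType.
apply: dynkin_induction.
- exact: measurable_prod_measurableType.
- move=> _ _ [A1 mA1 [A2 mA2 <-]] [B1 mB1 [B2 mB2 <-]].
  exists (A1 `&` B1); first exact: measurableI.
  exists (A2 `&` B2); first exact: measurableI.
  by rewrite setXI.
- by rewrite preimage_setT !setIT.
- move=> _ [B mB [B' mB' <-]].
  have [_] := rect _ _ (measurableI _ _ mI mB) (measurableI _ _ mI mB')
    (@subIsetl _ _ _) (@subIsetl _ _ _).
  have -> : YZ @^-1` ((`[yl, yr]%classic `&` B) `*` (`[yl, yr]%classic `&` B')) =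
      G `&` YZ @^-1` (B `*` B').
    by apply/seteqP; split => w /= [[? ?] [? ?]].
  by move=> <-; rewrite /E setIAC.
- move=> C mC IH.
  have PE : (P (E `&` YZ @^-1` (~` C)) = P E - P (E `&` YZ @^-1` C))%E.
    have := @measureD _ _ _ P _ _ mE (measurable_preYZ mC).
    rewrite (_ : E `\` _ = E `&` YZ @^-1` (~` C))// => ->//.
    by rewrite (le_lt_trans (probability_le1 P mE))// ltry.
  rewrite PE IH PG.
  have -> : YZ @^-1` (`[yl, yr]%classic `*` `[yl, yr]%classic) =
      (G `&` YZ @^-1` C) `|` (G `&` YZ @^-1` (~` C)).
    by rewrite -setIUr preimage_setC setUv setIT.
  rewrite ge0_integral_setU//; [|exact: mGS|exact: (mGS _ (measurableC mC))| |].
  + rewrite addeAC subee ?add0e//.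
    rewrite -IH fin_num_measure//.
    by apply: measurableI => //; exact: measurable_preYZ.
  + by rewrite -setIUr -preimage_setU setUv preimage_setT setIT.
  + by apply/disj_set2P; rewrite setIACA -preimage_setI setICr preimage_set0 setI0.
- move=> F mF tF IH.
  have tFY H : trivIset setT (fun n => H `&` YZ @^-1` F n).
    apply/trivIsetP => i j _ _ ij; rewrite setIACA.
    have /trivIsetP/(_ i j Logic.I Logic.I ij) Fij := tF.
    by rewrite -[X in _ `&` X]preimage_setI Fij preimage_set0 setI0.
  rewrite preimage_bigcup !setI_bigcupr.
  have mEF n : measurable (E `&` YZ @^-1` F n).
    by apply: measurableI => //; exact: measurable_preYZ.
  have -> : P (\bigcup_n (E `&` YZ @^-1` F n)) = (\sum_(0 <= n <oo) P (E `&` YZ @^-1` F n))%E.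
    by apply: measure_semi_bigcup => //; exact: bigcupT_measurable.
  rewrite (@ge0_integral_bigcup _ _ _ P (fun n => G `&` YZ @^-1` F n) g)//.
  + by apply: eq_eseriesr => n _; exact: IH.
  + by move=> n; exact: mGS.
  + rewrite -setI_bigcupr -preimage_bigcup; apply: mgS; exact: bigcupT_measurable.
Qed.

Definition psi (h : R -> R) (y z : R) : R := \int[KZ y z]_x h x.

Definition KZ_integrable (h : R -> R) := forall y z, yl <= y <= yr -> yl <= z <= yr ->
  (KZ y z).-integrable setT (EFin \o h).

Lemma KZ_eps h y z dl : continuous h -> KZ_integrable h ->
  yl <= y <= yr -> yl <= z <= yr -> 0 < dl ->
  exists2 eta, 0 < eta & forall y' z', yl <= y' <= yr -> yl <= z' <= yr ->
    `|y - y'| < eta -> `|z - z'| < eta -> `|psi h y z - psi h y' z'| <= dl.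
Proof.
move=> ch ih yin zin dl0.
have [eta eta0 H] := within_continuous_eps (KZ_law.2 h ch)
  (And3 yin zin (ih _ _ yin zin) : [set yz : R * R | [/\ yl <= yz.1 <= yr, yl <= yz.2 <= yr &
                 (KZ yz.1 yz.2).-integrable setT (EFin \o h)]] (y, z)) dl0.
exists eta => // y' z' y'in z'in yy' zz'; apply: (H (y', z')); last by split.
by split => //; exact: ih.
Qed.

Lemma KZ_disintegration S h : measurable S -> S `<=` square -> continuous h ->
  KZ_integrable h ->
  P.-integrable (YZ @^-1` S) (fun w => (psi h (Y ord0 w) (Z1 Y w))%:E) /\
  \int[P]_(w in YZ @^-1` S) h (X ord0 w) =
  \int[P]_(w in YZ @^-1` S) psi h (Y ord0 w) (Z1 Y w).
Proof.
move=> mS Ssq ch ih; have mG := measurable_preYZ mS.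
apply: (disintegration (measurable_funPT (X ord0)) mG).
- by move=> A mA; have [mg Pg] := KZ_law_ext mS Ssq mA.
- exact: continuous_measurable_fun.
- exact: X1_integrable.
- by move=> w /Ssq[/= h1 h2]; apply: ih; move: h1 h2; rewrite !in_itv.
Qed.

(** Multiplied out by the probability of [E], so that the estimate makes sense on null events and
    adds up over disjoint unions. *)
Definition near_mean (E : set T) (h : R -> R) (c dl : R) :=
  `|\int[P]_(w in E) h (X ord0 w) - c * fine (P E)| <= dl * fine (P E).

Lemma average_close (G : set T) (F : T -> R) (c dl : R) : measurable G ->
  P.-integrable G (EFin \o F) -> (forall w, G w -> `|F w - c| <= dl) ->
  `|\int[P]_(w in G) F w - c * fine (P G)| <= dl * fine (P G).
Proof.
move=> mG iF H.
have ic (k : R) : P.-integrable G (EFin \o cst k) by exact: finite_measure_integrable_cst.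
rewrite -!Rintegral_cst// -RintegralB//; last exact: (ic c).
apply: le_trans (le_normr_Rintegral mG _) _.
  by apply: (integrableB mG iF (ic c)).
apply: le_Rintegral => //; last exact: (ic dl).
by apply: (integrable_norm (f := fun w => F w - c)); exact: (integrableB mG iF (ic c)).
Qed.

(** The interval for [Z_1] is open on the left, so that [z1 < Z_1] means that some opponent exceeds
    [z1]. *)
Definition rect (a b z1 z2 : R) : set T := YZ @^-1` (`[a, b]%classic `*` `]z1, z2]%classic).

Lemma measurable_rect a b z1 z2 : measurable (rect a b z1 z2).
Proof. by apply: measurable_preYZ; apply: measurableX; exact: measurable_itv. Qed.

Lemma KZ_average h y z dl : continuous h -> KZ_integrable h ->
  yl <= y <= yr -> yl <= z <= yr -> 0 < dl ->
  exists2 eta, 0 < eta & forall a b z1 z2, yl <= a -> b <= yr -> yl <= z1 -> z2 <= yr ->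
    y - eta < a -> b < y + eta -> z - eta < z1 -> z2 < z + eta ->
    near_mean (rect a b z1 z2) h (psi h y z) dl.
Proof.
move=> ch ih yin zin dl0.
have [eta eta0 H] := KZ_eps ch ih yin zin dl0.
exists eta => // a b z1 z2 la br lz1 z2r ya yb zz1 zz2.
have Ssq : `[a, b]%classic `*` `]z1, z2]%classic `<=` square.
  move=> [p q] [/=]; rewrite !in_itv /= => /andP[p1 p2] /andP[q1 q2].
  by split; rewrite /= in_itv /=; lra.
have mS : measurable (`[a, b]%classic `*` `]z1, z2]%classic : set (R * R)).
  by apply: measurableX; exact: measurable_itv.
have [ip E] := KZ_disintegration mS Ssq ch ih.
rewrite /near_mean [X in `|X - _|]E; apply: average_close => //; first exact: measurable_rect.
move=> w Gw; have [/= s1 s2] := Ssq _ Gw; move: s1 s2 Gw => + + [/=].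
rewrite !in_itv /= => s1 s2 /andP[g1 g2] /andP[g3 g4].
by rewrite distrC; apply: H => //; rewrite ltr_distlC; lra.
Qed.

Lemma rect_gt0 a b z1 z2 : yl <= a -> a < b -> b <= yr -> yl <= z1 -> z1 < z2 -> z2 <= yr ->
  0 < fine (P (rect a b z1 z2)).
Proof.
move=> la ab br lz1 z12 z2r.
(* A box inside the rectangle: all opponents are in the upper half of []z1, z2]], which puts their
   maximum strictly above [z1]. *)
pose lo : 'rV[R]_m.+2 := \row_n (if n == ord0 then a else (z1 + z2) / 2).
pose hi : 'rV[R]_m.+2 := \row_n (if n == ord0 then b else z2).
have fb : fat_box lo hi by move=> n; rewrite !mxE; case: ifP => _; split; lra.
apply: lt_le_trans (box_event_fin_gt0 fb) _.
have mB := measurable_box_event lo hi; have mR := measurable_rect a b z1 z2.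
apply: fine_le; [exact: fin_num_measure|exact: fin_num_measure|].
rewrite le_measure ?inE// => w H; split; rewrite /= in_itv /=.
  by have := H ord0; rewrite !mxE eqxx.
apply/andP; split.
  apply: lt_le_trans (le_max_others _ ord0 ord0).
  by have := H (lift ord0 ord0); rewrite !mxE /= => /andP[]; lra.
by apply/max_others_leP => j; have := H (lift ord0 j); rewrite !mxE /= => /andP[].
Qed.

Lemma itv_near y eta : yl <= y <= yr -> 0 < eta ->
  exists a b, [/\ yl <= a, a < b, b <= yr, y - eta < a & b < y + eta].
Proof.
move=> yin eta0; have ylr := yl_lt_yr.
exists (Num.max yl (y - eta / 2)), (Num.min yr (y + eta / 2)).
rewrite le_max lexx ge_min lexx lt_max gt_min; split => //.
- by rewrite gt_max !lt_min; apply/andP; split; apply/andP; split; lra.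
- by apply/orP; right; lra.
- by apply/orP; right; lra.
Qed.

Lemma outside_mean0 G : measurable G -> \int[P]_(w in G) outside (X ord0 w) = 0.
Proof.
move=> mG; have mI := measurable_itv `[xl, xr].
have mN := measurableC (measurable_preX ord0 mI).
rewrite (Rintegral_setDnull mG mN (X1_integrable outside_continuous mG)); last first.
  exact: conull_setC (measurable_preX ord0 mI) X1_carried.
rewrite (@eq_Rintegral _ _ _ _ _ (cst 0)).
  by rewrite Rintegral_cst ?mul0r//; exact: measurableD.
by move=> w /set_mem[_ /= /contrapT]; rewrite in_itv /= => /outside0.
Qed.

(** [outside (X_1)] integrates to 0 over every event, and its averages over small rectangles near
    [(y, z)] approximate its mean under [KZ y z]. *)
Lemma KZ_carried y z : yl <= y <= yr -> yl <= z <= yr -> KZ y z `[xl, xr]%classic = 1%E.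
Proof.
move=> yin zin; apply: outside_carried; apply/eqP; rewrite -normr_le0.
apply/ler_addgt0Pl => dl dl0; rewrite addr0.
have io : KZ_integrable outside by move=> ? ? _ _; exact: outside_integrable.
have [eta eta0 H] := KZ_average outside_continuous io yin zin dl0.
have [a [b [la ab br ya yb]]] := itv_near yin eta0.
have [z1 [z2 [lz1 z12 z2r zz1 zz2]]] := itv_near zin eta0.
have r0 := rect_gt0 la ab br lz1 z12 z2r.
have := H a b z1 z2 la br lz1 z2r ya yb zz1 zz2.
rewrite /near_mean outside_mean0; last exact: measurable_rect.
by rewrite sub0r normrN normrM (ger0_norm (ltW r0)) (ler_pM2r r0).
Qed.

Lemma KZ_exists h : continuous h -> KZ_integrable h.
Proof. by move=> ch y z yin zin; exact: (carried_integrable (KZ_carried yin zin) ch). Qed.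

(** * Identification of [KZ] with a conditional law on a box *)

Lemma box_exp_perm h (s : 'S_m.+1) a b : fat_box a b ->
  box_exp K h (\row_n a 0 (perm_index s n)) (\row_n b 0 (perm_index s n)) = box_exp K h a b.
Proof.
move=> fb; set a' := \row_n _; set b' := \row_n _.
have fb' : fat_box a' b' by move=> n; rewrite !mxE; exact: fb.
have PE A : measurable A ->
    P (box_event a' b' `&` X ord0 @^-1` A) = P (box_event a b `&` X ord0 @^-1` A).
  move=> mA.
  have := symmetric_box symmetry s mA (fun n => measurable_itv `[a 0 n, b 0 n]).
  congr (P _ = P _); apply/seteqP; split => w /=.
  - by move=> [Aw H]; split => // n; have := H n; rewrite !mxE in_itv.
  - by move=> [H Aw]; split => // n; have := H n; rewrite !mxE in_itv.
  - by move=> [Aw H]; split => // n; have := H n; rewrite in_itv.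
  - by move=> [H Aw]; split => // n; have := H n; rewrite in_itv.
have PB : P (box_event a' b') = P (box_event a b).
  by have := PE setT measurableT; rewrite preimage_setT !setIT.
congr fine; apply: eq_measure_integral => A mA _.
have fK (nu : probability R R) : (fine (nu A))%:E = nu A by rewrite fineK ?fin_num_measure.
have p0 := box_event_fin_gt0 fb.
have fP : (fine (P (box_event a b)))%:E = P (box_event a b).
  by rewrite fineK ?fin_num_measure//; exact: measurable_box_event.
have := PE A mA; rewrite !box_law//; [|exact: fat_box_boxes..].
rewrite PB -fP -(fK (K a' b')) -(fK (K a b)) -!EFinM => -[E].
exact: etrans (esym (fK _)) (etrans (congr1 EFin (mulIf (lt0r_neq0 p0) E)) (fK _)).
Qed.

Lemma near_mean_setU E F h c dl : measurable E -> measurable F -> continuous h ->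
  E `&` F = set0 -> near_mean E h c dl -> near_mean F h c dl -> near_mean (E `|` F) h c dl.
Proof.
move=> mE mF ch EF hE hF; rewrite /near_mean Rintegral_setU//; last 2 first.
- by apply: X1_integrable => //; exact: measurableU.
- exact/disj_set2P.
rewrite measureU// fineD ?fin_num_measure//.
have -> (x y p q : R) : x + y - c * (p + q) = (x - c * p) + (y - c * q) by ring.
by rewrite mulrDr (le_trans (ler_normD _ _))// lerD.
Qed.

(* By symmetry, conditioning on [Y_1 = y] and [Z_1 = z] amounts to conditioning on
   [Y_1 = y], [Y_2 = z] and the remaining signals being at most [z]. *)
Definition corner_lo (y z : R) : 'rV[R]_m.+2 :=
  \row_n (if n == ord0 then y else if n == lift ord0 ord0 then z else yl).
Definition corner_hi (y z : R) : 'rV[R]_m.+2 := \row_n (if n == ord0 then y else z).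

Lemma corner_boxes y z : yl <= y <= yr -> yl <= z <= yr ->
  boxes yl yr (corner_lo y z, corner_hi y z).
Proof.
by move=> yin zin; split => n /=; rewrite !mxE; do ?case: ifP => _; lra.
Qed.

(** The null set off which signals stay in range and strict and weak comparisons with [z] agree. The
    union runs over [nat] through [inord], to suit the lemmas on countable unions. *)
Definition off_support (z : R) : set T :=
  \bigcup_k (Y (inord k) @^-1` (~` `[yl, yr]%classic) `|` Y (inord k) @^-1` [set z]).

Lemma off_supportE z w (n : 'I_m.+2) :
  (~ (yl <= Y n w <= yr)) \/ Y n w = z -> off_support z w.
Proof.
move=> h; exists (val n) => //; rewrite /= inord_val.
by case: h => h; [left|right] => //=; rewrite in_itv.
Qed.

Lemma off_support_null z : measurable (off_support z) /\ P (off_support z) = 0%E.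
Proof.
have mI := measurable_itv `[yl, yr].
have mA n : measurable (Y n @^-1` (~` `[yl, yr]%classic)).
  by apply: measurable_preY; exact: measurableC.
have mB n : measurable (Y n @^-1` [set z]) by apply: measurable_preY.
have mN : measurable (off_support z).
  by apply: bigcupT_measurable => k; exact: measurableU.
split=> //; apply/negligibleP => //; apply: negligible_bigcup => k; apply: negligibleU.
  apply/negligibleP => //; exact: conull_setC (measurable_preY _ mI) (Y_carried _).
by apply/negligibleP => //; exact: density_null_pt Y_density _ _.
Qed.

Let lift0F (i : 'I_m.+1) : (lift ord0 i == ord0) = false.
Proof. by rewrite eq_sym; exact: negbTE (neq_lift _ _). Qed.

(* The event [z1 < Z_1 <= z] is the disjoint union over [k] of these events, [k] being
   the first opponent whose signal exceeds [z1].  Each is a box up to a null set, and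
   exchanging [k] with the first opponent brings the box close to the limiting one. *)
Lemma piece_near_mean h y z dl : continuous h -> yl <= y <= yr -> yl < z <= yr -> 0 < dl ->
  exists2 eta, 0 < eta & forall a b z1 (k : 'I_m.+1), yl <= a -> a < b -> b <= yr ->
    yl < z1 -> z1 < z -> y - eta < a -> b < y + eta -> z - eta < z1 ->
    near_mean [set w | a <= Y ord0 w <= b /\ forall i : 'I_m.+1,
        (if i == k then z1 < Y (lift ord0 i) w else true) &&
        (Y (lift ord0 i) w <= if (i < k)%N then z1 else z)]
      h (box_exp K h (corner_lo y z) (corner_hi y z)) dl.
Proof.
move=> ch yin zin dl0.
have zin' : yl <= z <= yr by lra.
have [eta eta0 H] := box_exp_eps ch (corner_boxes yin zin')
  (fun a b ab => box_exists ch ab) dl0.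
exists eta => // a b z1 k la ab br lz1 z1z ya yb zz1.
(* Opponents before [k] are bounded above by [z1], opponent [k] lies between [z1] and [z], and those
   after [k] are bounded above by [z]. *)
pose A : 'rV[R]_m.+2 := \row_n (if n == ord0 then a else if n == lift ord0 k then z1 else yl).
pose B : 'rV[R]_m.+2 :=
  \row_n (if unlift ord0 n is Some i then (if (i < k)%N then z1 else z) else b).
have fb : fat_box A B.
  move=> n; rewrite !mxE; case: unliftP => [i ->|->]; last by rewrite eqxx; split.
  rewrite lift0F (inj_eq lift_inj); have [->|_] := eqVneq i k; first by rewrite ltnn; split; lra.
  by case: ifP => _; split; lra.
set piece := [set w | _].
have [mN N0] := off_support_null z1.
have eqE : piece `\` off_support z1 = box_event A B `\` off_support z1.
  apply/seteqP; split => w /= [H1 H2]; split => //.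
    move: H1 => [H0 H1] n; rewrite !mxE; have [i ->|->] := unliftP ord0 n; last by rewrite eqxx.
    have := H1 i; rewrite lift0F (inj_eq lift_inj).
    case: eqP => [->|_] /andP[h1 ->]; first by rewrite ltW.
    rewrite andbT leNgt; apply/negP => hz; apply: H2; apply: (@off_supportE _ _ (lift ord0 i)).
    by left => /andP[]; rewrite leNgt hz.
  split; first by have := H1 ord0; rewrite !mxE unlift_none eqxx.
  move=> i; have := H1 (lift ord0 i); rewrite !mxE liftK lift0F (inj_eq lift_inj).
  case: eqP => [->|_] /andP[h1 ->] //; rewrite andbT lt_neqAle h1 andbT.
  by apply/negP => /eqP hz; apply: H2; apply: (@off_supportE _ _ (lift ord0 k)); right.
have mP : measurable piece.
  rewrite (_ : piece = Y ord0 @^-1` `[a, b]%classic `&`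
    \bigcap_(i in [set: 'I_m.+1]) Y (lift ord0 i) @^-1`
      ((if i == k then `]z1, +oo[%classic else setT) `&`
       `]-oo, (if (i < k)%N then z1 else z)]%classic)).
    apply: measurableI; first by apply: measurable_preY; exact: measurable_itv.
    apply: fin_bigcap_measurable; first exact: finite_finset.
    move=> i _; apply: measurable_preY; apply: measurableI; last exact: measurable_itv.
    by case: ifP => _ //; exact: measurable_itv.
  apply/seteqP; split => w /= [h1 h2]; split; rewrite ?in_itv//; try by move: h1; rewrite in_itv.
    move=> i _ /=; have := h2 i; rewrite in_itv /= => /andP[h3 h4]; split => //.
    by move: h3; case: ifP => _ //=; rewrite in_itv /= andbT.
  move=> i; have := h2 i Logic.I; rewrite /= in_itv /= => -[h3 ->]; rewrite andbT.
  by move: h3; case: ifP => _ //=; rewrite in_itv /= andbT.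
have mB := measurable_box_event A B.
rewrite /near_mean (Rintegral_null_congr mP mB mN N0 eqE); last exact: X1_integrable.
rewrite (probability_null_congr mP mB mN N0 eqE).
rewrite (fat_box_exp fb ch (box_exists ch (fat_box_boxes fb))).
have p0 := box_event_fin_gt0 fb.
rewrite -mulrBl normrM (ger0_norm (ltW p0)) (ler_pM2r p0) distrC.
(* After the exchange the lower bound [z1] belongs to the first opponent and the others have [yl].
   Every endpoint is then within [eta] of the limiting one, whether the upper bound is [z1] or
   [z]. *)
rewrite -(box_exp_perm h (tperm ord0 k) fb); apply: H.
- by apply: fat_box_boxes => n; have := fb (perm_index (tperm ord0 k) n); rewrite !mxE.
- move=> n; rewrite !mxE /perm_index; case: unliftP => [i ->|->]; last first.
    by rewrite !eqxx ltr_distlC; lra.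
  rewrite !lift0F !(inj_eq lift_inj) (_ : (tperm ord0 k i == k) = (i == ord0)).
    by case: ifP => _; rewrite ltr_distlC; lra.
  by rewrite -{2}(tpermL ord0 k) (inj_eq perm_inj).
- move=> n; rewrite !mxE /perm_index; case: (unliftP ord0 n) => [i ->|->]; last first.
    by rewrite unlift_none eqxx ltr_distlC; lra.
  rewrite liftK lift0F.
  by case: ifP => _; rewrite ltr_distlC; lra.
Qed.

Lemma rect_near_mean h y z dl : continuous h -> yl <= y <= yr -> yl < z <= yr -> 0 < dl ->
  exists2 eta, 0 < eta & forall a b z1, yl <= a -> a < b -> b <= yr ->
    yl < z1 -> z1 < z -> y - eta < a -> b < y + eta -> z - eta < z1 ->
    near_mean (rect a b z1 z) h (box_exp K h (corner_lo y z) (corner_hi y z)) dl.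
Proof.
move=> ch yin zin dl0; have [eta eta0 H] := piece_near_mean ch yin zin dl0.
exists eta => // a b z1 la ab br lz1 z1z ya yb zz1.
have {}H k := H a b z1 k la ab br lz1 z1z ya yb zz1.
(* With [Y_1] in [[a, b]], these events decrease from [Z_1 <= z] to [Z_1 <= z1]. The difference of
   [St k] and [St k.+1] is the piece where opponent [k] is the first above [z1], and the estimates
   add up over the pieces. *)
pose St (k : nat) := [set w | a <= Y ord0 w <= b /\ forall i : 'I_m.+1,
  Y (lift ord0 i) w <= if (i < k)%N then z1 else z].
have mSt k : measurable (St k).
  rewrite (_ : St k = Y ord0 @^-1` `[a, b]%classic `&`
    \bigcap_(i in [set: 'I_m.+1]) Y (lift ord0 i) @^-1`
      `]-oo, (if (i < k)%N then z1 else z)]%classic).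
    apply: measurableI; first by apply: measurable_preY; exact: measurable_itv.
    apply: fin_bigcap_measurable; first exact: finite_finset.
    by move=> i _; apply: measurable_preY; exact: measurable_itv.
  apply/seteqP; split => w /= [h1 h2]; split; rewrite ?in_itv//; try by move: h1; rewrite in_itv.
    by move=> i _ /=; rewrite in_itv /=; exact: h2.
  by move=> i; have := h2 i Logic.I; rewrite /= in_itv.
have step k : (k <= m.+1)%N -> near_mean (St 0%N `\` St k) h
    (box_exp K h (corner_lo y z) (corner_hi y z)) dl.
  elim: k => [_|k IH km].
    by rewrite setDv /near_mean Rintegral_set0 measure0 !mulr0 subrr normr0.
  pose ko := Ordinal km.
  rewrite (_ : St 0%N `\` St k.+1 = (St 0%N `\` St k) `|` (St k `\` St k.+1)).
    apply: near_mean_setU => //; first exact: measurableD.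
    - exact: measurableD.
    - by apply/seteqP; split => w //= -[[_ h1] [/h1]].
    - exact/IH/ltnW.
    rewrite (_ : St k `\` St k.+1 = [set w | a <= Y ord0 w <= b /\ forall i : 'I_m.+1,
        (if i == ko then z1 < Y (lift ord0 i) w else true) &&
        (Y (lift ord0 i) w <= if (i < ko)%N then z1 else z)]); first exact: H.
    apply/seteqP; split => w /=.
      move=> [[h0 h1] h2]; split => // i; rewrite h1 andbT.
      case: eqP => // ->; rewrite ltNge; apply/negP => h3; apply: h2; split => // j.
      rewrite ltnS leq_eqVlt; have [jk|jk] := eqVneq (j : nat) k.
        by rewrite (_ : j = ko)//; exact: val_inj.
      exact: h1.
    move=> [h0 h1]; split; first by split => // i; have /andP[] := h1 i.
    move=> [_ /(_ ko)]; have := h1 ko; rewrite eqxx /= leqnn => /andP[h3 _].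
    by rewrite leNgt h3.
  apply/seteqP; split => w /=.
    by move=> [h0 h1]; have [h2|h2] := pselect (St k w); [right|left].
  move=> [[h0 h1]|[[h0 h1] h2]]; split => //.
    move=> [h2 h3]; apply: h1; split => // i; apply: le_trans (h3 i) _.
    case: ifPn => i1; case: ifPn => i2 //; first exact: ltW.
    by rewrite (ltn_trans i2)// in i1.
  by split => // i; apply: le_trans (h1 i) _; case: ifP => // _; exact: ltW.
rewrite (_ : rect a b z1 z = St 0%N `\` St m.+1); first exact: step.
apply/seteqP; split => w /=.
  move=> [/=]; rewrite !in_itv /= => h0 /andP[h1 h2]; split.
    by split => // i; have /max_others_leP := h2; exact.
  move=> [_ h3]; move: h1; rewrite ltNge => /negP; apply.
  by apply/max_others_leP => i; have := h3 i; rewrite ltn_ord.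
move=> [[h0 h1] h2]; split; rewrite /= in_itv //=; apply/andP; split; last first.
  by apply/max_others_leP => i; exact: h1.
rewrite ltNge; apply/negP => /max_others_leP h3; apply: h2; split => // i.
by rewrite ltn_ord.
Qed.

(** Both sides are within [dl / 2] of the average of [h (X_1)] over one small rectangle next to
    [(y, z)], which has positive probability. *)
Lemma KZ_box h y z : continuous h -> yl <= y <= yr -> yl < z <= yr ->
  psi h y z = box_exp K h (corner_lo y z) (corner_hi y z).
Proof.
move=> ch yin zin; set c := box_exp _ _ _ _.
apply/eqP; rewrite -subr_eq0 -normr_le0; apply/ler_addgt0Pl => dl dl0; rewrite addr0.
have dl2 : 0 < dl / 2 by rewrite divr_gt0.
have zin' : yl <= z <= yr by lra.
have [e1 e10 H1] := KZ_average ch (KZ_exists ch) yin zin' dl2.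
have [e2 e20 H2] := rect_near_mean ch yin zin dl2.
pose e := Num.min e1 e2.
have e0 : 0 < e by rewrite lt_min e10.
have [ee1 ee2] : e <= e1 /\ e <= e2 by rewrite /e !ge_min !lexx orbT.
have [a [b [la ab br ya yb]]] := itv_near yin e0.
(* The first term keeps [z1] above [yl], the second keeps it within [e] of [z]. *)
pose z1 := Num.max ((yl + z) / 2) (z - e / 2).
have lz1 : yl < z1 by rewrite lt_max; apply/orP; left; lra.
have zz1 : z - e < z1 by rewrite lt_max; apply/orP; right; lra.
have z1z : z1 < z by rewrite gt_max; apply/andP; split; lra.
have p0 : 0 < fine (P (rect a b z1 z)) by apply: rect_gt0 => //; lra.
have := H1 a b z1 z la br (ltW lz1) ltac:(lra) ltac:(lra) ltac:(lra) ltac:(lra) ltac:(lra).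
have := H2 a b z1 la ab br lz1 z1z ltac:(lra) ltac:(lra) ltac:(lra).
rewrite /near_mean -/c => h2 h1; rewrite -(ler_pM2r p0).
rewrite -{1}(ger0_norm (ltW p0)) -normrM mulrBl.
set I := Rintegral _ _ _ in h1 h2; set p := fine _ in h1 h2 p0 *.
rewrite (_ : psi h y z * p - c * p = (I - c * p) - (I - psi h y z * p)); last by ring.
by rewrite (le_trans (ler_normB _ _))// (_ : dl * p = dl / 2 * p + dl / 2 * p) ?lerD//; field.
Qed.

(** * Monotonicity of the conditional expectations *)

Lemma box_exp_step h n a b a' b' : continuous h -> {homo h : x y / x < y} ->
  boxes yl yr (a, b) -> boxes yl yr (a', b') ->
  (forall k, k != n -> a' 0 k = a 0 k /\ b' 0 k = b 0 k) ->
  (a 0 n < a' 0 n /\ b' 0 n = b 0 n) \/ (a' 0 n = a 0 n /\ b 0 n < b' 0 n) ->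
  if n == ord0 then box_exp K h a b < box_exp K h a' b'
  else box_exp K h a b <= box_exp K h a' b'.
Proof.
by move=> ch hi ab ab' H1 H2; apply: K_pos_dep => //; exact: box_exists.
Qed.

(** Positive dependence moves one coordinate of one corner at a time; these are the intermediate
    corners, with the coordinates in [s] already moved. *)
Definition mix (s : seq 'I_m.+2) (v v' : 'rV[R]_m.+2) : 'rV[R]_m.+2 :=
  \row_n (if n \in s then v' 0 n else v 0 n).

Lemma box_exp_le_hi h a b b' : continuous h -> {homo h : x y / x < y} ->
  boxes yl yr (a, b) -> boxes yl yr (a, b') -> (forall n, b 0 n <= b' 0 n) ->
  box_exp K h a b <= box_exp K h a b'.
Proof.
move=> ch hi [/= ca cb ab] [/= _ cb' ab'] bb'.
have mixb s : boxes yl yr (a, mix s b b').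
  by split => //= n; rewrite !mxE; case: ifP.
suff H s : box_exp K h a b <= box_exp K h a (mix s b b').
  have := H (enum 'I_m.+2); rewrite (_ : mix _ b b' = b')//.
  by apply/rowP => n; rewrite !mxE mem_enum.
elim: s => [|k s IH].
  by rewrite (_ : mix [::] b b' = b)//; apply/rowP => n; rewrite !mxE.
apply: le_trans IH _.
(* A coordinate that does not change is set apart, because positive dependence speaks of strict
   moves. *)
have [E|ne] := eqVneq (mix s b b' 0 k) (mix (k :: s) b b' 0 k).
  rewrite (_ : mix (k :: s) b b' = mix s b b')//; apply/rowP => n.
  by have [->|nk] := eqVneq n k => //; rewrite !mxE inE (negbTE nk).
have := @box_exp_step h k _ _ _ _ ch hi (mixb s) (mixb (k :: s)).
case: ifP => _ H; [apply: ltW|]; apply: H => [n nk|];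
  try by split=> //; rewrite !mxE inE (negbTE nk).
- right; split => //; rewrite lt_neqAle ne /=.
  by rewrite !mxE inE eqxx /=; case: ifP.
- right; split => //; rewrite lt_neqAle ne /=.
  by rewrite !mxE inE eqxx /=; case: ifP.
Qed.

Lemma box_exp_le_lo h a a' b : continuous h -> {homo h : x y / x < y} ->
  boxes yl yr (a, b) -> boxes yl yr (a', b) -> (forall n, a 0 n <= a' 0 n) ->
  box_exp K h a b <= box_exp K h a' b.
Proof.
move=> ch hi [/= ca cb ab] [/= ca' _ ab'] aa'.
have mixa s : boxes yl yr (mix s a a', b).
  by split => //= n; rewrite !mxE; case: ifP.
suff H s : box_exp K h a b <= box_exp K h (mix s a a') b.
  have := H (enum 'I_m.+2); rewrite (_ : mix _ a a' = a')//.
  by apply/rowP => n; rewrite !mxE mem_enum.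
elim: s => [|k s IH].
  by rewrite (_ : mix [::] a a' = a)//; apply/rowP => n; rewrite !mxE.
apply: le_trans IH _.
have [E|ne] := eqVneq (mix s a a' 0 k) (mix (k :: s) a a' 0 k).
  rewrite (_ : mix (k :: s) a a' = mix s a a')//; apply/rowP => n.
  by have [->|nk] := eqVneq n k => //; rewrite !mxE inE (negbTE nk).
have := @box_exp_step h k _ _ _ _ ch hi (mixa s) (mixa (k :: s)).
case: ifP => _ H; [apply: ltW|]; apply: H => [n nk|];
  try by split=> //; rewrite !mxE inE (negbTE nk).
- left; split => //; rewrite lt_neqAle ne /=.
  by rewrite !mxE inE eqxx /=; case: ifP.
- left; split => //; rewrite lt_neqAle ne /=.
  by rewrite !mxE inE eqxx /=; case: ifP.
Qed.

(** The upper corner is raised before the lower one, so that every intermediate box is nonempty. The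
    strict gain comes from the lower endpoint for [Y_1], which is moved alone. *)
Lemma box_exp_lt h a b a' b' : continuous h -> {homo h : x y / x < y} ->
  boxes yl yr (a, b) -> boxes yl yr (a', b') ->
  (forall n, a 0 n <= a' 0 n) -> (forall n, b 0 n <= b' 0 n) -> a 0 ord0 < a' 0 ord0 ->
  box_exp K h a b < box_exp K h a' b'.
Proof.
move=> ch hi ab ab' aa' bb' a0.
have [/= ca cb abn] := ab; have [/= ca' cb' abn'] := ab'.
have ab1 : boxes yl yr (a, b').
  by split => //= n; rewrite (le_trans (abn n)).
have ab2 : boxes yl yr (mix [:: ord0] a a', b').
  split => //= n; rewrite !mxE; case: ifP => // _.
  by rewrite (le_trans (abn n)).
apply: le_lt_trans (box_exp_le_hi ch hi ab ab1 bb') _.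
apply: (@lt_le_trans _ _ (box_exp K h (mix [:: ord0] a a') b')); last first.
  by apply: box_exp_le_lo => // n; rewrite !mxE; case: ifP.
have := @box_exp_step h ord0 _ _ _ _ ch hi ab1 ab2; rewrite eqxx; apply.
  by move=> k k0; rewrite !mxE inE (negbTE k0).
by left; rewrite !mxE inE eqxx.
Qed.

(** Allowing [z <= z'] covers two uses: along the diagonal, where bids are seen to increase, and at
    fixed [z], where a higher own signal raises the expected value. *)
Lemma psi_lt h y z y' z' : continuous h -> {homo h : x y / x < y} ->
  yl <= y -> y < y' -> y' <= yr -> yl < z -> z <= z' -> z' <= yr ->
  psi h y z < psi h y' z'.
Proof.
move=> ch hi ly yy' y'r lz zz' z'r.
rewrite !KZ_box//; try lra; apply: box_exp_lt => //.
- by apply: corner_boxes; lra.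
- by apply: corner_boxes; lra.
- by move=> n; rewrite !mxE; do ?case: ifP => _ //; lra.
- by move=> n; rewrite !mxE; do ?case: ifP => _ //; lra.
- by rewrite !mxE.
Qed.

End Boxes.

(** * Revenue *)

(** Preimages of rays are intervals. *)
Lemma measurable_increasing_on (R : realType) (D : set R) (g : R -> R) :
  is_interval D -> {in D &, {homo g : x y / x < y}} -> measurable_fun D g.
Proof.
move=> iD gi; have mD := is_interval_measurable iD.
have gle x y : D x -> D y -> x <= y -> g x <= g y.
  by move=> Dx Dy; rewrite le_eqVlt => /orP[/eqP ->//|xy]; apply/ltW/gi => //; exact: mem_set.
apply: (measurability (@RGenCInfty.G R)) => [|/= _ [_] [r] -> <-].
  exact: RGenCInfty.measurableE.
apply: is_interval_measurable => s t [/= Ds gs] [/= Dt gt] v /andP[sv vt].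
have Dv : D v by apply: (iD s t) => //; rewrite sv.
split => //; move: gs gt; rewrite /= !in_itv /= !andbT => gs _.
by rewrite (le_trans gs)// gle.
Qed.

Section RintegralSum.
Context d (T : measurableType d) (R : realType) (mu : {measure set T -> \bar R}).

Lemma Rintegral_sum (I : Type) (s : seq I) (D : set T) (h : I -> T -> R) : measurable D ->
  (forall i, mu.-integrable D (EFin \o h i)) ->
  mu.-integrable D (fun w => (\sum_(i <- s) h i w)%:E) /\
  \int[mu]_(w in D) (\sum_(i <- s) h i w) = \sum_(i <- s) \int[mu]_(w in D) h i w.
Proof.
move=> mD ih.
have iS (r : seq I) : mu.-integrable D (fun w => (\sum_(i <- r) h i w)%:E).
  rewrite (_ : (fun w => _) = (fun w => \sum_(i <- r) (h i w)%:E)%E).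
    by apply: integrable_sum => // i _; exact: ih.
  by apply/funext => w; rewrite sumEFin.
split=> //; elim: s => [|i s IH].
  by rewrite big_nil; under eq_Rintegral do rewrite big_nil; rewrite Rintegral_cst// mul0r.
rewrite big_cons -IH -RintegralD//; first by apply: eq_Rintegral => w _; rewrite big_cons.
exact: iS.
Qed.

End RintegralSum.

Section Revenue.
Context d (T : measurableType d) (R : realType) (P : probability T R) (m : nat).
Context (X Y : 'I_m.+2 -> {RV P >-> R}) (xl xr yl yr el er : R) (f : m.+2.-tuple R -> R).
Context (K : 'rV[R]_m.+2 -> 'rV[R]_m.+2 -> probability R R).
Context (KZ : R -> R -> probability R R) (u c : R -> R).
Hypothesis symmetry : symmetric_law X Y.
Hypothesis X_values : is_support P (X ord0) `[xl, xr].
Hypothesis Y_values : is_support P (Y ord0) `[yl, yr].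
Hypothesis Y_density : is_joint_density P Y f.
Hypothesis Y_density_pos : forall y : m.+2.-tuple R,
     (forall i, yl <= tnth y i <= yr) -> 0 < f y.
Hypothesis K_law : box_cond_law yl yr (X ord0) Y K.
Hypothesis K_pos_dep : positive_dependence yl yr K.
Hypothesis K_cont : box_continuity yl yr K.
Hypothesis KZ_law : Z1_cond_law yl yr (X ord0) Y KZ.
Hypothesis u_concave : concave_function u.
Hypothesis u_incr : {homo u : x y / x < y}.
Hypothesis u0 : u 0 = 0.

(** The left endpoint is excluded because [KZ_box], and with it monotonicity in the signal, needs
    room below [z]. *)
Let D : set R := `]yl, yr]%classic.

Let nuP z : D z -> KZ z z `[xl, xr]%classic = 1%E.
Proof.
rewrite /D /= in_itv /= => zD.
by apply: (KZ_carried symmetry X_values Y_values Y_density Y_density_pos KZ_law); lra.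
Qed.

Let psi_incr h y z y' z' : continuous h -> {homo h : x y / x < y} ->
  yl <= y -> y < y' -> y' <= yr -> yl < z -> z <= z' -> z' <= yr ->
  psi KZ h y z < psi KZ h y' z'.
Proof.
exact: (psi_lt symmetry X_values Y_values Y_density Y_density_pos K_law K_pos_dep K_cont KZ_law).
Qed.

Let kap := kappa c el er.
Let tau alpha z := tbid KZ u c el er alpha z z.

(* Measuring bids in this way makes their defining equation free of the effort:
   the mean utility of [(1 - alpha) X - net_bid] is zero. *)
Definition net_bid alpha z := (1 - alpha) * tau alpha z - kap alpha.

Lemma zero_utility_bidE alpha y z b :
  zero_utility_bid KZ u c el er alpha y z b <->
  mean_util (KZ y z) u (1 - alpha) ((1 - alpha) * b - kap alpha) = 0.
Proof.
rewrite /zero_utility_bid /mean_util.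
have -> : \int[KZ y z]_x win_utility u c el er alpha b x =
    \int[KZ y z]_x util u (1 - alpha) ((1 - alpha) * b - kap alpha) x.
  by apply: eq_Rintegral => x _; rewrite /win_utility /util; congr u; rewrite /kap; ring.
by [].
Qed.

Lemma net_bid_root alpha z : 0 <= alpha < 1 -> D z ->
  mean_util (KZ z z) u (1 - alpha) (net_bid alpha z) = 0.
Proof.
move=> a01 Dz; have nz := nuP Dz.
have k0 : 0 <= 1 - alpha by lra.
have [s _ Es] := mean_util_root nz u_concave u_incr u0 k0.
pose b := (s + kap alpha) / (1 - alpha).
have bE : (1 - alpha) * b - kap alpha = s by rewrite /b; field; lra.
(* Existence and uniqueness of the root make the [xget] in [tbid] return it rather than its
   default. *)
have ub : unique (zero_utility_bid KZ u c el er alpha z z) b.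
  split; first by apply/zero_utility_bidE; rewrite bE.
  move=> b' /zero_utility_bidE E'.
  have := mean_util_inj nz u_concave u_incr Es E'; rewrite -bE => E.
  have : (1 - alpha) * b = (1 - alpha) * b' by lra.
  by apply: mulfI; lra.
have [tz _] := xgetPex 0 (ex_intro (fun b => unique _ b) b ub).
exact/zero_utility_bidE.
Qed.

(** The utility at the net bid of [z] increases with the nominal value, so its mean rises from 0 to
    a positive number when the conditioning moves from [z] to [z']. Since mean utility decreases in
    the net bid, the root at [z'] is larger. *)
Lemma net_bid_lt alpha : 0 <= alpha < 1 -> {in D &, {homo net_bid alpha : z z' / z < z'}}.
Proof.
move=> a01 z z' /set_mem Dz /set_mem Dz' zz'.
have Ez := net_bid_root a01 Dz; have Ez' := net_bid_root a01 Dz'.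
have lt : 0 < mean_util (KZ z' z') u (1 - alpha) (net_bid alpha z).
  rewrite -Ez; move: Dz Dz'; rewrite /D /= !in_itv /= => Dz Dz'.
  apply: (@psi_incr (util u (1 - alpha) (net_bid alpha z)) z z z' z') => //; try lra.
    exact: util_continuous.
  move=> x y xy; apply: u_incr; rewrite ltrD2r ltr_pM2l//; lra.
rewrite ltNge; apply/negP; rewrite le_eqVlt => /orP[/eqP E|].
  by move: lt; rewrite -E Ez' ltxx.
move=> /(mean_util_decr (nuP Dz') u_concave u_incr (1 - alpha)); rewrite Ez' => h.
by have := lt_trans lt h; rewrite ltxx.
Qed.

Lemma tau_lt alpha : 0 <= alpha < 1 -> {in D &, {homo tau alpha : z z' / z < z'}}.
Proof.
move=> a01 z z' Dz Dz' /(net_bid_lt a01 Dz Dz'); rewrite /net_bid ltrD2r ltr_pM2l//; lra.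
Qed.

Lemma net_bid_bounds alpha z : 0 <= alpha < 1 -> D z ->
  (1 - alpha) * xl <= net_bid alpha z <= (1 - alpha) * xr.
Proof.
move=> a01 Dz; have nz := nuP Dz.
have k0 : 0 <= 1 - alpha by lra.
have [s sb Es] := mean_util_root nz u_concave u_incr u0 k0.
by rewrite (mean_util_inj nz u_concave u_incr (net_bid_root a01 Dz) Es).
Qed.

(* Outside [D] the values of [KZ] are arbitrary. *)
Definition net_bid0 alpha := net_bid alpha \_ D.

Lemma measurable_net_bid0 alpha : 0 <= alpha < 1 -> measurable_fun setT (net_bid0 alpha).
Proof.
move=> a01; apply/measurable_restrict => //; first exact: measurable_itv.
rewrite setTI; apply: measurable_increasing_on; first exact: interval_is_interval.
exact: net_bid_lt.
Qed.

(** Almost surely the case. Then bids are ordered as the signals, exactly one buyer wins, and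
    [net_bid0] agrees with [net_bid] at the highest other signal. *)
Definition good (w : T) := (forall n, D (Y n w)) /\ (forall n k, n != k -> Y n w != Y k w).

Lemma good_ae : exists N, [/\ measurable N, P N = 0%E & forall w, ~ N w -> good w].
Proof.
have [mO O0] := off_support_null symmetry Y_values Y_density yl.
pose F (i j : nat) : set T := if (inord i : 'I_m.+2) != inord j then
  [set w | Y (inord i) w = Y (inord j) w] else set0.
have F0 i j : measurable (F i j) /\ P (F i j) = 0%E.
  rewrite /F; case: ifPn => // ij; split; last exact: density_null_diag Y_density _ _ ij.
  rewrite (_ : [set _ | _] = (fun w => Y (inord i) w - Y (inord j) w) @^-1` [set 0]).
    have := measurable_funB (measurable_funPT (Y (inord i))) (measurable_funPT (Y (inord j))).
    by move=> /(_ measurableT _ (measurable_set1 0)); rewrite setTI.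
  by apply/seteqP; split => w /= => [->|/eqP]; rewrite ?subrr ?subr_eq0// => /eqP.
exists (off_support Y yl yr yl `|` \bigcup_i \bigcup_j F i j); split.
- apply: measurableU => //; apply: bigcupT_measurable => i; apply: bigcupT_measurable => j.
  by have [] := F0 i j.
- apply/negligibleP.
    apply: measurableU => //; apply: bigcupT_measurable => i; apply: bigcupT_measurable => j.
    by have [] := F0 i j.
  apply: negligibleU; first exact/negligibleP.
  apply: negligible_bigcup => i; apply: negligible_bigcup => j.
  by have [? ?] := F0 i j; apply/negligibleP.
- move=> w Nw; split => [n|n k nk].
    rewrite /D /= in_itv /=; apply/andP; split.
      rewrite ltNge; apply/negP => h; apply: Nw; left; apply: (@off_supportE _ _ _ _ _ _ _ _ _ _ n).
      have [->|ne] := eqVneq (Y n w) yl; first by right.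
      by left => /andP[h1 _]; move: ne; rewrite eq_le h h1.
    rewrite leNgt; apply/negP => h; apply: Nw; left; apply: (@off_supportE _ _ _ _ _ _ _ _ _ _ n).
    by left => /andP[_]; rewrite leNgt h.
  apply/negP => /eqP E; apply: Nw; right; exists n => //; exists k => //.
  by rewrite /F !inord_val nk.
Qed.

Lemma good_winner w : good w -> exists n0, forall n, (maxY Y n w < Y n w) = (n == n0).
Proof.
move=> [_ ne]; have [n0 _ nmax] := arg_maxP (fun n => Y n w) (erefl true : xpredT (ord0 : 'I_m.+2)).
exists n0 => n; apply/idP/eqP => [h|->].
  apply/eqP/negPn/negP => nn0; have [j Ej] : exists j, n0 = lift n j.
    by apply: lift_neq; rewrite eq_sym.
  have := (max_others_ltP (fun k => Y k w) n (Y n w)).1 h j.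
  by rewrite -Ej ltNge; have := nmax n erefl; rewrite /= => ->.
apply/(max_others_ltP (fun k => Y k w)) => j.
have nl : lift n0 j != n0 by rewrite eq_sym neq_lift.
by rewrite lt_neqAle (ne _ _ nl) /=; exact: nmax.
Qed.

Lemma good_maxY w n : good w -> D (maxY Y n w).
Proof.
move=> [Dw _]; have [j] := max_others_attained (fun k => Y k w) n.
by rewrite /maxY => ->; exact: Dw.
Qed.

(* [b + alpha (x + effort alpha - b)] at [v = (x, (y, z))], where the second
   highest bid [b] satisfies [(1 - alpha) b = net_bid alpha z + kap alpha]. *)
Definition receipt alpha (v : R * (R * R)) : R :=
  alpha * v.1 + alpha * effort c el er alpha + net_bid0 alpha v.2.2 + kap alpha.

Lemma receipts_good alpha w : 0 <= alpha < 1 -> good w ->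
  seller_receipts X Y KZ u c el er alpha w =
  \sum_(n < m.+2 | maxY Y n w < Y n w) receipt alpha (X n w, (Y n w, maxY Y n w)).
Proof.
move=> a01 gw; have [Dw _] := gw.
have mE n : max_others (bid Y KZ u c el er alpha w) n = tau alpha (maxY Y n w).
  exact: (max_others_homo n Dw (tau_lt a01)).
have wE n : wins Y KZ u c el er alpha w n = (maxY Y n w < Y n w).
  rewrite /wins mE; have Dm := good_maxY n gw.
  apply/idP/idP => [|/(tau_lt a01 (mem_set Dm) (mem_set (Dw n)))//].
  rewrite /bid -/(tau _ _) => h; rewrite ltNge le_eqVlt; apply/negP => /orP[/eqP E|].
    by move: h; rewrite E ltxx.
  by move=> /(tau_lt a01 (mem_set (Dw n)) (mem_set Dm)) h'; have := lt_trans h h'; rewrite ltxx.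
rewrite /seller_receipts; apply: eq_big => n; first by rewrite wE.
move=> _; rewrite mE /receipt /net_bid0 /= patchE (mem_set (good_maxY n gw)) /net_bid.
by rewrite /=; ring.
Qed.

Let V n w := (X n w, (Y n w, maxY Y n w)).
Let A n := [set w | maxY Y n w < Y n w].
Let N : R := m.+2%:R.

Let above : set (R * R) := [set yz | yz.2 < yz.1].

Let measurable_above : measurable above.
Proof.
have := measurable_funB (@measurable_fst _ _ R R) (@measurable_snd _ _ R R).
move=> /(_ measurableT _ (measurable_itv `]0, +oo[)); rewrite setTI.
by congr measurable; apply/seteqP; split => -[y z]; rewrite /above /= in_itv /= andbT subr_gt0.
Qed.

Let measurable_A n : measurable (A n).
Proof.
have mYZ : measurable_fun setT (fun w => (Y n w, maxY Y n w)).
  by apply: measurable_fun_pair => //; exact: measurable_maxY.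
by have := mYZ measurableT _ measurable_above; rewrite setTI.
Qed.

(** By symmetry every buyer contributes the same integral over the event of winning. A constant [F]
    gives the winning probability, [F = receipt alpha] the revenue. *)
Lemma symmetric_sum (F : R * (R * R) -> R) (g : T -> R) : measurable_fun setT F ->
  P.-integrable (A ord0) (fun w => (F (V ord0 w))%:E) ->
  P.-integrable setT (EFin \o g) ->
  (forall w, good w -> g w = \sum_(n < m.+2 | maxY Y n w < Y n w) F (V n w)) ->
  \int[P]_w g w = N * \int[P]_(w in A ord0) F (V ord0 w).
Proof.
move=> mF iF ig gE.
have HF n := symmetric_integral symmetry n measurable_above mF iF.
pose h n w := ((F \o V n) \_ (A n)) w.
have ih n : P.-integrable setT (EFin \o h n).
  rewrite (_ : EFin \o h n = (EFin \o (F \o V n)) \_ (A n)); last first.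
    by rewrite -restrict_EFin.
  exact: ((integrable_mkcond _ (measurable_A n)).1 (HF n).1).
have [iS ES] := Rintegral_sum (index_enum 'I_m.+2) measurableT ih.
have [Nn [mN N0 NG]] := good_ae.
transitivity (\int[P]_w \sum_(n < m.+2) h n w).
  rewrite (Rintegral_setDnull measurableT mN ig N0) (Rintegral_setDnull measurableT mN iS N0).
  apply: eq_Rintegral => w /set_mem[_ /NG gw]; rewrite gE// big_mkcond; apply: eq_bigr => n _.
  rewrite /h patchE; case: ifPn => wn; first by rewrite mem_set.
  by rewrite memNset// /A /=; exact/negP.
rewrite ES (eq_bigr (fun=> \int[P]_(w in A ord0) F (V ord0 w))).
  by rewrite sumr_const card_ord mulr_natl.
by move=> n _; rewrite -Rintegral_mkcond; exact: (HF n).2.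
Qed.

Lemma winner_prob : N * fine (P (A ord0)) = 1.
Proof.
have i1 (G : set T) : measurable G -> P.-integrable G (EFin \o cst 1).
  by move=> mG; exact: finite_measure_integrable_cst.
have := @symmetric_sum (cst 1) (cst 1) (measurable_cst _) (i1 _ (measurable_A ord0))
  (i1 _ measurableT).
rewrite !Rintegral_cst// [X in fine X](probability_setT P) !mul1r => <- // w gw.
have [n0 n0E] := good_winner gw.
by rewrite (eq_bigl (pred1 n0))// big_pred1_eq.
Qed.

Lemma winner_prob_gt0 : 0 < fine (P (A ord0)).
Proof. by rewrite -(@pmulr_rgt0 _ N) ?winner_prob// ltr0n. Qed.

Lemma net_bid0_integrable alpha G : 0 <= alpha < 1 -> measurable G ->
  P.-integrable G (fun w => (net_bid0 alpha (maxY Y ord0 w))%:E).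
Proof.
move=> a01 mG.
apply: (@measurable_bounded_integrable _ _ _ P (fun w => net_bid0 alpha (maxY Y ord0 w))) => //.
- by rewrite (le_lt_trans (probability_le1 P mG))// ltry.
- apply: measurable_funTS; apply: measurableT_comp; first exact: measurable_net_bid0.
  exact: measurable_maxY.
- exists (`|xl| + `|xr|); split => // M hM w _ /=; rewrite /net_bid0 patchE.
  apply: le_trans (ltW hM); case: ifPn => [/set_mem Dz|_]; last by rewrite normr0 addr_ge0.
  have /andP[b1 b2] := net_bid_bounds a01 Dz.
  have ab x : `|(1 - alpha) * x| <= `|x|.
    by rewrite normrM ler_piMl// ger0_norm; lra.
  move: (ab xl) (ab xr); rewrite !ler_norml => /andP[? ?] /andP[? ?].
  have := normr_ge0 xl; have := normr_ge0 xr => *.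
  by apply/andP; split; lra.
Qed.

Let X_integrable G : measurable G -> P.-integrable G (EFin \o X ord0).
Proof.
by move=> mG; apply: (X1_integrable X_values (h := id)) => // x; exact: cvg_id.
Qed.

Let cst_integrable G (k : R) : measurable G -> P.-integrable G (EFin \o cst k).
Proof. by move=> mG; exact: finite_measure_integrable_cst. Qed.

Let integrable_addr G (g h : T -> R) : measurable G -> P.-integrable G (EFin \o g) ->
  P.-integrable G (EFin \o h) -> P.-integrable G (EFin \o (fun w => g w + h w)).
Proof. by move=> mG ig ih; have := integrableD mG ig ih. Qed.

Let integrable_mulr G k (g : T -> R) : measurable G -> P.-integrable G (EFin \o g) ->
  P.-integrable G (EFin \o (fun w => k * g w)).
Proof. by move=> mG ig; have := integrableZl mG k ig. Qed.

Lemma receipt_integral alpha G : 0 <= alpha < 1 -> measurable G ->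
  P.-integrable G (fun w => (receipt alpha (V ord0 w))%:E) /\
  \int[P]_(w in G) receipt alpha (V ord0 w) =
  alpha * (\int[P]_(w in G) X ord0 w) + \int[P]_(w in G) net_bid0 alpha (maxY Y ord0 w) +
  (alpha * effort c el er alpha + kap alpha) * fine (P G).
Proof.
move=> a01 mG.
have iX := integrable_mulr alpha mG (X_integrable mG).
have iB := net_bid0_integrable a01 mG.
have iC := cst_integrable (alpha * effort c el er alpha + kap alpha) mG.
have i2 := integrable_addr mG (integrable_addr mG iX iB) iC.
have E w : receipt alpha (V ord0 w) = alpha * X ord0 w + net_bid0 alpha (maxY Y ord0 w) +
    (alpha * effort c el er alpha + kap alpha) by rewrite /receipt /V /=; ring.
split.
  rewrite (_ : (fun w => _) = (EFin \o (fun w => alpha * X ord0 w +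
    net_bid0 alpha (maxY Y ord0 w) + (alpha * effort c el er alpha + kap alpha))))//.
  by apply/funext => w; rewrite E.
under eq_Rintegral do rewrite E.
rewrite RintegralD//; last exact: integrable_addr mG iX iB.
by rewrite RintegralD// RintegralZl// ?Rintegral_cst//; exact: X_integrable.
Qed.

(** * Revenue as an expectation given that the distinguished buyer wins *)

Hypothesis fin_t : forall alpha, 0 <= alpha < 1 ->
  P.-integrable setT (fun w => (tau alpha (Z1 Y w))%:E).
Hypothesis fin_receipts : forall alpha, 0 <= alpha < 1 ->
  P.-integrable setT (EFin \o seller_receipts X Y KZ u c el er alpha).

Let I_X := \int[P]_(w in A ord0) X ord0 w.
Let I_B alpha := \int[P]_(w in A ord0) net_bid0 alpha (maxY Y ord0 w).

Lemma measurable_receipt alpha : 0 <= alpha < 1 -> measurable_fun setT (receipt alpha).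
Proof.
move=> a01; do ?apply: measurable_funD => //.
  by apply: measurable_funM => //; exact: measurable_fst.
apply: measurableT_comp; first exact: measurable_net_bid0.
by apply: measurableT_comp; exact: measurable_snd.
Qed.

Lemma revenue_receipt alpha : 0 <= alpha < 1 ->
  revenue X Y KZ u c el er alpha = N * \int[P]_(w in A ord0) receipt alpha (V ord0 w).
Proof.
move=> a01; apply: symmetric_sum.
- exact: measurable_receipt.
- by have [] := receipt_integral a01 (measurable_A ord0).
- exact: fin_receipts.
- by move=> w; exact: receipts_good.
Qed.

Lemma revenueE alpha : 0 <= alpha < 1 ->
  revenue X Y KZ u c el er alpha =
  N * (alpha * I_X + I_B alpha) + alpha * effort c el er alpha + kap alpha.
Proof.
move=> a01; rewrite revenue_receipt// (receipt_integral a01 (measurable_A ord0)).2.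
by rewrite mulrDr (mulrCA N) winner_prob mulr1 -/I_X -/(I_B _); ring.
Qed.

Lemma revenue_eq_formula alpha : 0 <= alpha < 1 ->
  revenue X Y KZ u c el er alpha = revenue_formula X Y KZ u c el er alpha.
Proof.
move=> a01; rewrite revenue_receipt// /revenue_formula /cond_expectation.
have p0 := winner_prob_gt0.
(* [N] is the inverse of the winning probability, hence the normalisation of the conditional
   expectation. *)
rewrite -[[set w | _]]/(A ord0) -[N](mulfK (lt0r_neq0 p0)) winner_prob mul1r mulrC.
congr (_ / _).
have [Nn [mN N0 NG]] := good_ae.
have mA := measurable_A ord0.
have i1 := (receipt_integral a01 mA).1.
pose g w := alpha * X ord0 w + alpha * effort c el er alpha + (1 - alpha) * tau alpha (Z1 Y w).
have i2 : P.-integrable (A ord0) (EFin \o g).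
  apply: integrable_addr => //; first apply: integrable_addr => //.
  - by apply: integrable_mulr => //; exact: X_integrable.
  - exact: (cst_integrable (alpha * effort c el er alpha)).
  - apply: integrable_mulr => //.
    by apply: integrableS (fin_t a01).
rewrite (Rintegral_setDnull mA mN i1 N0) -[RHS]/(\int[P]_(w in A ord0) g w).
rewrite (Rintegral_setDnull mA mN i2 N0).
apply: eq_Rintegral => w /set_mem[_ /NG gw].
rewrite /receipt /g /V /net_bid0 /= patchE (mem_set (good_maxY ord0 gw)) /net_bid.
by rewrite -[Z1 Y w]/(maxY Y ord0 w); ring.
Qed.

(** * Slopes of the net bid at 0 *)

Let q alpha z := (net_bid0 alpha z - net_bid0 0 z) / alpha.
Let H alpha := N * \int[P]_(w in A ord0) q alpha (maxY Y ord0 w).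

Let net_bid0E alpha z : D z -> net_bid0 alpha z = net_bid alpha z.
Proof. by move=> Dz; rewrite /net_bid0 patchE mem_set. Qed.

Let net_bid_root0 z : D z -> mean_util (KZ z z) u 1 (net_bid 0 z) = 0.
Proof. by move=> Dz; rewrite -[1]subr0 net_bid_root// lexx ltr01. Qed.

Let net_bid0_out alpha z : ~ D z -> net_bid0 alpha z = 0.
Proof. by move=> Dz; rewrite /net_bid0 patchE memNset. Qed.

Lemma slope_nonincreasing alpha beta z : 0 < beta -> beta <= alpha -> alpha < 1 ->
  q alpha z <= q beta z.
Proof.
move=> b0 ba a1; rewrite /q; have [Dz|Dz] := pselect (D z); last first.
  by rewrite !net_bid0_out// subrr !mul0r.
rewrite !net_bid0E//; apply: (mean_util_root_concave (nuP Dz) u_concave u_incr).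
- by rewrite b0.
- exact: net_bid_root0.
- by apply: net_bid_root => //; lra.
- by apply: net_bid_root => //; lra.
Qed.

Lemma slope_le alpha z : 0 < alpha < 1 -> q alpha z <= `|xl|.
Proof.
move=> a01; rewrite /q; have [Dz|Dz] := pselect (D z); last first.
  by rewrite !net_bid0_out// subrr mul0r.
rewrite !net_bid0E//.
have a0 : 0 <= alpha by lra.
have a01' : 0 <= alpha < 1 by lra.
have /andP[_ h] := mean_util_root_bounds (nuP Dz) u_concave u_incr a0
  (net_bid_root0 Dz) (net_bid_root a01' Dz).
rewrite ler_pdivrMr; last lra.
have : - xl * alpha <= `|xl| * alpha.
  by rewrite ler_wpM2r// -normrN ler_norm.
lra.
Qed.

Lemma slope_ge alpha z : 0 < alpha < 1 -> D z -> - psi KZ id z z <= q alpha z.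
Proof.
move=> a01 Dz; rewrite /q !net_bid0E//.
have a01' : 0 <= alpha <= 1 by lra.
have a01'' : 0 <= alpha < 1 by lra.
have := mean_util_root_Jensen (nuP Dz) u_concave u_incr u0 a01'
  (net_bid_root0 Dz) (net_bid_root a01'' Dz).
rewrite -[Rintegral _ _ _]/(psi KZ id z z) => h.
by rewrite ler_pdivlMr; lra.
Qed.

Lemma slope_integral alpha G : 0 < alpha < 1 -> measurable G ->
  P.-integrable G (fun w => (q alpha (maxY Y ord0 w))%:E) /\
  \int[P]_(w in G) q alpha (maxY Y ord0 w) =
  (\int[P]_(w in G) net_bid0 alpha (maxY Y ord0 w) -
   \int[P]_(w in G) net_bid0 0 (maxY Y ord0 w)) / alpha.
Proof.
move=> a01 mG; have a01' : 0 <= alpha < 1 by lra.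
have z01 : (0 : R) <= (0 : R) < 1 by rewrite lexx ltr01.
have i1 := net_bid0_integrable a01' mG.
have i2 := net_bid0_integrable z01 mG.
have i3 : P.-integrable G (EFin \o (fun w => net_bid0 alpha (maxY Y ord0 w) -
    net_bid0 0 (maxY Y ord0 w))) by have := integrableB mG i1 i2.
have E w : q alpha (maxY Y ord0 w) = alpha^-1 * (net_bid0 alpha (maxY Y ord0 w) -
    net_bid0 0 (maxY Y ord0 w)) by rewrite /q mulrC.
split.
  have := integrable_mulr alpha^-1 mG i3; apply: eq_integrable => // w _.
  by rewrite /= E.
under eq_Rintegral do rewrite E.
by rewrite RintegralZl// RintegralB// mulrC.
Qed.

Lemma revenue_quotient alpha : 0 < alpha < 1 ->
  (revenue X Y KZ u c el er alpha - revenue X Y KZ u c el er 0) / alpha =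
  N * I_X + H alpha + (effort c el er alpha + (kap alpha - kap 0) / alpha).
Proof.
move=> a01; rewrite !revenueE; [|lra|lra].
rewrite /H (slope_integral a01 (measurable_A ord0)).2 -!/(I_B _).
by field; lra.
Qed.

(** [H] is nonincreasing on []0, 1[] and bounded above by [|xl|], so its right limit at 0 is its
    supremum and no limit is taken under the integral. *)
Lemma slope_mean_cvg : H alpha @[alpha --> 0^'+] --> sup (H @` `]0, 1[%classic) /\
  forall alpha, 0 < alpha < 1 -> H alpha <= sup (H @` `]0, 1[%classic).
Proof.
have mA := measurable_A ord0.
have N0 : 0 <= N by rewrite ler0n.
have ub : has_ubound (H @` `]0, 1[%classic).
  exists `|xl| => _ [alpha /= + <-]; rewrite in_itv /= => a01.
  rewrite /H -[leRHS]mulr1 -winner_prob mulrCA ler_wpM2l// -Rintegral_cst//.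
  apply: le_Rintegral => //; first exact: (slope_integral a01 mA).1.
    exact: (cst_integrable `|xl|).
  by move=> w _; exact: slope_le.
split; last by move=> alpha a01; apply: ub_le_sup => //; exists alpha; rewrite //= in_itv.
apply: (@nonincreasing_at_right_cvgr _ H 0 (BLeft 1)) => //; first by rewrite bnd_simp.
move=> a b; rewrite !in_itv /= => a01 b01 ba.
rewrite /H ler_wpM2l//; apply: le_Rintegral => //.
- exact: (slope_integral b01 mA).1.
- exact: (slope_integral a01 mA).1.
- by move=> w _; apply: slope_nonincreasing; lra.
Qed.

(** Over [Y_1 > Z_1], disintegration replaces [X_1] by [psi KZ id Y_1 Z_1], and [psi KZ id Y_1 Z_1 >
    psi KZ id Z_1 Z_1 >= - q alpha Z_1] makes the integrand positive. *)
Lemma slope_mean_gt0 alpha : 0 < alpha < 1 -> 0 < N * I_X + H alpha.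
Proof.
move=> a01; rewrite /H -mulrDr mulr_gt0 ?ltr0n//.
have mA := measurable_A ord0.
have iX := X_integrable mA; have [iq _] := slope_integral a01 mA.
rewrite /I_X -RintegralD//.
(* A triangle and not a rectangle, hence the recourse to [KZ_law_ext] behind the disintegration. *)
pose S : set (R * R) := above `&` (D `*` D).
have mS : measurable S.
  by apply: measurableI => //; apply: measurableX; exact: measurable_itv.
have DE z : D z -> yl < z <= yr by rewrite /D /= in_itv.
have Ssq : S `<=` square yl yr.
  by move=> [y z] [_ [/= /DE h1 /DE h2]]; split; rewrite /= in_itv /=; lra.
pose G := (fun w => (Y ord0 w, Z1 Y w)) @^-1` S.
have mG : measurable G by exact: (measurable_preYZ Y mS).
have [Nn [mN N0 NG]] := good_ae.
have AG : A ord0 `\` Nn = G `\` Nn.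
  apply/seteqP; split => w [h1 h2]; split => //; last by case: h1.
  by split => //; split; [exact: (NG _ h2).1|exact: (good_maxY ord0 (NG _ h2))].
have iXq G' : measurable G' -> P.-integrable G' (fun w => (X ord0 w + q alpha (maxY Y ord0 w))%:E).
  move=> mG'; apply: integrable_addr => //; first exact: X_integrable.
  exact: (slope_integral a01 mG').1.
rewrite (Rintegral_null_congr mA mG mN N0 AG); last exact: iXq.
have cid : continuous (@id R) by move=> x; exact: cvg_id.
have [ip E] := KZ_disintegration X_values KZ_law mS Ssq cid
  (KZ_exists symmetry X_values Y_values Y_density Y_density_pos KZ_law cid).
have iqG := (slope_integral a01 mG).1.
have PG : (0 < P G)%E.
  rewrite -(probability_null_congr mA mG mN N0 AG) lt_neqAle measure_ge0 andbT.
  by apply/eqP => PA0; have := winner_prob_gt0; rewrite -PA0 ltxx.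
rewrite RintegralD//; last exact: X_integrable.
rewrite [X in X + _]E -RintegralD//; apply: Rintegral_gt0 => //.
- exact: integrable_addr.
- move=> w [/= zy [/DE yD zD]]; have zD' := DE _ zD.
  have := slope_ge a01 zD; rewrite -[Z1 Y w]/(maxY Y ord0 w) in zD' *.
  have : psi KZ id (maxY Y ord0 w) (maxY Y ord0 w) < psi KZ id (Y ord0 w) (maxY Y ord0 w).
    by apply: psi_incr => //; move: zy; rewrite /above /=; try lra.
  lra.
Qed.

Lemma revenue_right_derivative :
  convex_function (`[el, er]%classic : set R) c ->
  (forall alpha, 0 <= alpha < 1 -> exists! e, best_effort c el er alpha e) ->
  exists2 D : R, right_derivative_at0 (revenue X Y KZ u c el er) D & 0 < D.
Proof.
move=> c_convex effort_unique.
have [Hcvg Hle] := slope_mean_cvg.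
exists (N * I_X + sup (H @` `]0, 1[%classic)).
  rewrite /right_derivative_at0 -[X in _ --> X]addr0.
  apply: cvg_trans (cvgD (cvgD (cvg_cst (N * I_X)) Hcvg) (envelope_cvg0 c_convex effort_unique)).
  apply: near_eq_cvg; near=> alpha; rewrite revenue_quotient//.
  by apply/andP; split; near: alpha; [exact: nbhs_right_gt|exact: nbhs_right_lt].
(* Any point of []0, 1[] would do, since the limit is a supremum over this interval. *)
have h2 : (0 : R) < 2^-1 :> R by rewrite invr_gt0.
have a01 : 0 < (2^-1 : R) < 1 by rewrite h2 invf_lt1 ?ltr1n.
by apply: lt_le_trans (slope_mean_gt0 a01) _; rewrite lerD2l Hle.
Unshelve. all: by end_near. Qed.

End Revenue.

Theorem proposition6 (d : measure_display) (T : measurableType d)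
  (R : realType) (P : probability T R) (m : nat)
  (X Y : 'I_m.+2 -> {RV P >-> R})
  (xl xr yl yr el er : R)
  (f : m.+2.-tuple R -> R)
  (K : 'rV[R]_m.+2 -> 'rV[R]_m.+2 -> probability R R)
  (KZ : R -> R -> probability R R)
  (u c dc : R -> R)
  (X_continuous : forall n, continuous (cdf (X n)))
  (symmetry : symmetric_law X Y)
  (X_values : is_support P (X ord0) `[xl, xr])
  (Y_values : is_support P (Y ord0) `[yl, yr])
  (Y_density : is_joint_density P Y f)
  (Y_density_pos : forall y : m.+2.-tuple R,
     (forall i, yl <= tnth y i <= yr) -> 0 < f y)
  (K_law : box_cond_law yl yr (X ord0) Y K)
  (K_pos_dep : positive_dependence yl yr K)
  (K_cont : box_continuity yl yr K)
  (KZ_law : Z1_cond_law yl yr (X ord0) Y KZ)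
  (u_concave : concave_function u)
  (u_incr : {homo u : x y / x < y})
  (u0 : u 0 = 0)
  (u_participation : forall y, cube yl yr y -> 0 < box_exp K u y y)
  (c_ge0 : forall e, el <= e <= er -> 0 <= c e)
  (c_incr : {in `[el, er] &, {homo c : x y / x < y}})
  (c_convex : convex_function (`[el, er]%classic : set R) c)
  (c_C1 : C1_on el er c dc)
  (dc_inf : inf [set dc e | e in `[el, er]] < 1)
  (dc_sup : 1 < sup [set dc e | e in `[el, er]])
  (effort_unique : forall alpha, 0 <= alpha < 1 ->
     exists! e, best_effort c el er alpha e)
  (fin_u : forall y, cube yl yr y -> box_exp_exists K u y y)
  (fin_win : forall alpha b y z, 0 <= alpha < 1 ->
     yl <= y <= yr -> yl <= z <= yr ->
     (KZ y z).-integrable setT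
       (EFin \o win_utility u c el er alpha b))
  (fin_t : forall alpha, 0 <= alpha < 1 ->
     P.-integrable setT
       (fun w => (tbid KZ u c el er alpha (Z1 Y w) (Z1 Y w))%:E))
  (fin_receipts : forall alpha, 0 <= alpha < 1 ->
     P.-integrable setT
       (EFin \o seller_receipts X Y KZ u c el er alpha)) :
  (forall alpha, 0 <= alpha < 1 ->
     revenue X Y KZ u c el er alpha = revenue_formula X Y KZ u c el er alpha) /\
  exists2 D : R, right_derivative_at0 (revenue X Y KZ u c el er) D & 0 < D.
Proof.
split => [alpha a01|].
  exact: (revenue_eq_formula symmetry X_values Y_values Y_density Y_density_pos
    K_law K_pos_dep K_cont KZ_law u_concave u_incr u0 fin_t fin_receipts a01).
exact: (revenue_right_derivative symmetry X_values Y_values Y_density Y_density_pos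
  K_law K_pos_dep K_cont KZ_law u_concave u_incr u0 fin_receipts c_convex effort_unique).
Qed.
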